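(* There exist universal constants $C_1,c_1>0$ such that the following holds. Let $(X,d)$ be a compact $\lambda$-doubling metric space, and let $\mu$ be a Borel probability measure on $X$. Then for every integer $t\ge 1$ there exist a compact subset $S\subseteq X$ and a Borel probability measure $\nu$ supported on $S$ satisfying: 1. The ultrametric distortion of $S$ is at most $16t$. 2. For every $x\in X$ and $r\in[0,\infty)$, $$\nu(B_d(x,r))\le \lambda^{2/t}\cdot \mu\bigl(B_d(x,C_1 t r)\bigr)^{1-1/t}.$$ 3. For every $y\in S$ and $r\in[0,\infty)$ there exists $x\in X$ such that $B_d(x,c_1 r/t)\subseteq B_d(y,r)$ and $$\nu(B_d(y,r))\ge \frac{\lambda^{-2/t}}{2}\cdot \mu\bigl(B_d(x,c_1 r/t)\bigr)^{1-1/t}.$$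
   Context: For a metric space $(X,d)$, $x\in X$, $r\ge0$, $B_d(x,r)=\{y\in X: d(x,y)\le r\}$ is the closed ball. For $\lambda\in\mathbb N$, a metric space $(X,d)$ is called $\lambda$-doubling if any bounded subset $Z\subseteq X$ can be covered by at most $\lambda$ subsets of diameter at most $\operatorname{diam}_d(Z)/2$. An ultrametric on a set $U$ is a metric $\rho$ satisfying $\rho(x,y)\le\max\{\rho(x,z),\rho(y,z)\}$ for all $x,y,z\in U$. A metric space $(S,d)$ embeds with distortion $D\in[1,\infty)$ into an ultrametric space if there exists an ultrametric $\rho$ on $S$ with $d(x,y)\le\rho(x,y)\le D\,d(x,y)$ for all $x,y\in S$. The ultrametric distortion of $S$ (with the restricted metric) is the infimum of all $D$ for which $S$ embeds in an ultrametric with distortion at most $D$. Universal constants do not depend on $X,d,\lambda,\mu,t$. *)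

(* Defs.v *)
From HB Require Import structures.
From mathcomp Require Import all_boot all_order all_algebra.
From mathcomp Require Import all_classical all_reals all_analysis.

Set Implicit Arguments.
Unset Strict Implicit.
Unset Printing Implicit Defensive.

Import Order.TTheory GRing.Theory Num.Theory.

Local Open Scope classical_set_scope.
Local Open Scope ring_scope.

(* The base point is only there because [measurableType] extends
   [pointedType]; a space carrying a probability measure is nonempty. *)
#[short(type="pmetricType")]
HB.structure Definition PointedMetric (K : numDomainType) :=
  {M of Pointed M & Metric K M}.

(* A copy of X whose measurable sets are the Borel sets of X. *)
Notation borel X := (g_sigma_algebraType (@open X)).

(* Not the library's [closed_ball], which is the closure of the open ball. *)
Definition mcball (R : realType) (X : metricType R) (x : X) (r : R) : set X :=
  [set y | mdist x y <= r].

Definition mbounded (R : realType) (X : metricType R) (A : set X) : Prop :=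
  exists M : R, forall x y, A x -> A y -> mdist x y <= M.

(* The adjoined 0 makes the diameter of the empty set 0 rather than -oo. *)
Definition diam (R : realType) (X : metricType R) (A : set X) : \bar R :=
  ereal_sup (0%E |` [set (mdist x y)%:E | x in A & y in A]).

(* The pieces C i may be empty or repeated: "at most lambda" of them. *)
Definition doubling (R : realType) (X : metricType R) (lambda : nat) : Prop :=
  forall Z : set X, mbounded Z ->
    exists C : 'I_lambda -> set X,
      Z `<=` \bigcup_i C i /\
      forall i, (diam (C i) <= (2^-1)%:E * diam Z)%E.

Definition metric_on (R : realType) (T : Type) (S : set T)
    (rho : T -> T -> R) : Prop :=
  [/\ forall x y, S x -> S y -> 0 <= rho x y,
      forall x y, S x -> S y -> (rho x y = 0 <-> x = y),
      forall x y, S x -> S y -> rho x y = rho y x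
    & forall x y z, S x -> S y -> S z -> rho x y <= rho x z + rho z y].

Definition ultrametric_on (R : realType) (T : Type) (S : set T)
    (rho : T -> T -> R) : Prop :=
  metric_on S rho /\
  forall x y z, S x -> S y -> S z -> rho x y <= Num.max (rho x z) (rho y z).

Definition embeds_ultrametric (R : realType) (X : metricType R) (S : set X)
    (D : R) : Prop :=
  exists rho : X -> X -> R, ultrametric_on S rho /\
    forall x y, S x -> S y -> mdist x y <= rho x y <= D * mdist x y.

(* +oo when S embeds in an ultrametric space with no finite distortion. *)
Definition ultrametric_distortion (R : realType) (X : metricType R)
    (S : set X) : \bar R :=
  ereal_inf [set D%:E | D in [set D : R | 1 <= D /\ embeds_ultrametric S D]].

Definition supported_on (R : realType) (X : pmetricType R)
    (nu : probability (borel X) R) (S : set X) : Prop :=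
  nu (~` S) = 0%E.

(* Main.v *)
Require Import Defs.
From HB Require Import structures.
From mathcomp Require Import all_boot all_order all_algebra.
From mathcomp Require Import all_classical all_reals all_analysis.
From mathcomp Require Import ring lra zify.

Set Implicit Arguments.
Unset Strict Implicit.
Unset Printing Implicit Defensive.

Import Order.TTheory GRing.Theory Num.Theory.

Local Open Scope classical_set_scope.
Local Open Scope ring_scope.

(** The measure [nu] lives on the ends of a tree of closed pieces of [X]. At
    level [k] the pieces have diameter at most [64 * t * e k], where
    [e k = e0 / 2 ^+ k], and distinct pieces are at distance at least
    [8 * e k]. Two points of [S] that separate at level [k.+1] are thus at
    distance between [4 * e k] and [64 * t * e k]; this is the ultrametric
    distortion [16 * t].

    A piece [P] is split by repeatedly carving out a cluster around the centre
    [x] whose ball of radius [r] carries the largest mass [a] among what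
    remains. Among the [t] rings between the radii [r] and [2 * r], one
    increases the mass by a factor at most [(b / a) `^ t^-1], where [b] is the
    mass of the ball of radius [2 * r]; the cluster [Q] is the part inside this
    ring, and the ring is thrown away ([split_cells]). As [r] halves from level
    to level, [b] is at most the maximal mass [a] of the parent, so that these
    factors telescope: the weight [w Q = mu Q * a `^ (- t^-1)] satisfies
    [w P <= \sum w Q] over the clusters [Q] of [P]. Doubling gives
    [a <= mu Q <= lambda ^ 2 * a], hence
    [mu Q `^ (1 - t^-1) <= w Q <= lambda `^ (2 / t) * mu Q `^ (1 - t^-1)].

    Some children are then dropped, so that the mass of [P] can be shared among
    the others with [nu Q] between [mu Q `^ (1 - t^-1) / 2] and [w Q]
    ([balanced_sublist], [exists_node_tree]). A ball of radius [r] meets [S] in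
    at most one piece of diameter of order [t * r], which gives the upper bound;
    if it is centred in [S], it contains a piece of diameter of order [r], which
    gives the lower one.

    The lower bound compares [nu Q] with the mass of a full ball, although
    discarded rings may come close to every point of a cluster. For this reason
    all pieces are unions of nested cubes in the style of Christ, each of which
    contains a ball of comparable radius ([exists_nested_cubes]). The cubes are
    closed and may overlap: the splitting only uses that [mu] is monotone and
    subadditive, and every point of [S] belongs to a piece of each level, not
    only to its closure, which matters for the atoms of [mu], that is for the
    radius [0]. Finally [nu] is the image of Lebesgue measure on [[0, 1[], cut at each
    level into intervals whose lengths are the masses of the pieces
    ([exists_tree_measure]). *)

(** * Balls and unions of cells in a compact metric space *)

Lemma mdist_triangle3 (R : realType) (X : metricType R) (x y a b : X) :
  mdist x y <= mdist a x + mdist a b + mdist b y.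
Proof.
have := metric_triangle x a y; have := metric_triangle a b y.
by rewrite (metric_sym x a); lra.
Qed.

Lemma closure_mdist (R : realType) (X : metricType R) (A : set X) (x : X) :
  closure A x -> forall e, 0 < e -> exists2 w, A w & mdist x w < e.
Proof.
move=> cA e e0; have [w [Aw]] := cA _ (nbhsx_ballx x e e0).
by rewrite ballEmdist /= => xw; exists w.
Qed.

Lemma mcball_setC_open (R : realType) (X : metricType R) (x : X) (r : R) :
  open (~` mcball x r).
Proof.
rewrite openE => y; rewrite /mcball /= => /negP; rewrite -ltNge => xy.
rewrite /interior; apply/metricType_numDomainType.nbhs_mdistP => /=.
exists (mdist x y - r) => /=; first by rewrite subr_gt0.
move=> z /= yz; apply/negP; rewrite -ltNge.
by have := metric_triangle x z y; rewrite (metric_sym z y); lra.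
Qed.

Lemma closed_mcball (R : realType) (X : metricType R) (x : X) (r : R) :
  closed (mcball x r).
Proof. by rewrite -openC; exact: mcball_setC_open. Qed.

Lemma mcball_center (R : realType) (X : metricType R) (x : X) (r : R) :
  0 <= r -> mcball x r x.
Proof. by rewrite /mcball /= mdistxx. Qed.

Lemma compact_finite_net (R : realType) (X : pmetricType R) (e : R) :
  compact [set: X] -> 0 < e ->
  exists s : seq X, forall x, exists2 y, y \in s & mdist x y < e.
Proof.
rewrite compact_cover => cX e0.
have [||D _ cD] := cX X setT (fun x => (ball x e)°).
- by move=> i _; exact: open_interior.
- by move=> x _; exists x => //; exact: nbhsx_ballx.
exists (finmap.enum_fset D) => x; have [y /= yD /interior_subset xy] := cD x Logic.I.
by exists y => //; move: xy; rewrite ballEmdist /= metric_sym.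
Qed.

Lemma compact_bounded (R : realType) (X : pmetricType R) :
  compact [set: X] -> exists2 M : R, 0 < M & forall x y : X, mdist x y <= M.
Proof.
move=> cX; have [s sP] := compact_finite_net cX (@ltr01 R).
pose m := \sum_(p <- allpairs pair s s) (mdist p.1 p.2).
have m0 : 0 <= m by apply: sumr_ge0 => ? _; exact: mdist_ge0.
exists (m + 2) => [|x y]; first lra.
have [a sa xa] := sP x; have [b sb yb] := sP y.
have abm : mdist a b <= m.
  rewrite /m (big_rem (a, b)) /=; last by apply/allpairsP; exists (a, b).
  by rewrite lerDl; apply: sumr_ge0 => ? _; exact: mdist_ge0.
have := mdist_triangle3 x y a b; rewrite (metric_sym a x) (metric_sym b y).
by lra.
Qed.

Definition separated (R : realType) (X : metricType R) (e : R) (s : seq X) :=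
  forall x y, x \in s -> y \in s -> x != y -> e < mdist x y.

(** Nets are enlarged rather than chosen afresh at each scale, so that every
    net point is its own parent; this makes a cube the union of its children. *)
Lemma separated_net_extend (R : realType) (X : pmetricType R) (e : R)
    (s0 : seq X) :
  compact [set: X] -> 0 < e -> separated (e / 2) s0 ->
  exists s : seq X, [/\ {subset s0 <= s}, separated (e / 2) s &
    forall x, exists2 y, y \in s & mdist x y <= e].
Proof.
move=> cX e0 sep0; have e20 : 0 < e / 2 by rewrite divr_gt0.
have [g gP] := compact_finite_net cX e20.
suff [s [s0s seps gs]] : exists s : seq X, [/\ {subset s0 <= s},
    separated (e / 2) s &
    forall x, x \in g -> exists2 y, y \in s & mdist x y <= e / 2].
  exists s; split => // x; have [y /gs[z zs yz] xy] := gP x.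
  by exists z => //; have := metric_triangle x y z; lra.
elim: g {gP} => [|a g [s [s0s seps gs]]]; first by exists s0; split.
have [[y ys ay]|h] := pselect (exists2 y, y \in s & mdist a y <= e / 2).
  by exists s; split => // x; rewrite inE => /predU1P[->|xg]; [exists y|exact: gs].
exists (a :: s); split.
- by move=> x /s0s xs; rewrite inE xs orbT.
- move=> x y; rewrite !inE => /predU1P[->|xs] /predU1P[->|ys] xy.
  + by rewrite eqxx in xy.
  + by rewrite ltNge; apply/negP => le; apply: h; exists y => //.
  + rewrite ltNge; apply/negP => le; apply: h.
    by exists x => //; rewrite metric_sym.
  + exact: seps.
- move=> x; rewrite inE => /predU1P[->|xg].
    by exists a; rewrite ?mem_head// mdistxx ltW.
  by have [y ys xy] := gs _ xg; exists y => //; rewrite inE ys orbT.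
Qed.

Definition cells (I : choiceType) (T : Type) (C : I -> set T) (Z : seq I) :
    set T :=
  \bigcup_(u in [set` Z]) C u.

Lemma closed_cells (I : choiceType) (T : topologicalType) (C : I -> set T)
    (Z : seq I) :
  (forall u, u \in Z -> closed (C u)) -> closed (cells C Z).
Proof. by move=> cC; apply: closed_bigcup => //; exact: finite_seq. Qed.

Lemma cells_sub (I : choiceType) (T : Type) (C : I -> set T) (Y Z : seq I) :
  {subset Y <= Z} -> cells C Y `<=` cells C Z.
Proof. by move=> YZ; apply: bigcup_subset => u /=; exact: YZ. Qed.

(** * Nested closed cubes *)

Lemma seq_argmax (R : realType) (T : eqType) (f : T -> R) (s : seq T) :
  s != [::] -> exists2 y, y \in s & forall z, z \in s -> f z <= f y.
Proof.
elim: s => // a [_ _|b s IH _].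
  by exists a; rewrite ?mem_head// => z; rewrite inE => /eqP ->.
have [//|y ys yP] := IH; have [le|lt] := leP (f y) (f a).
  exists a; rewrite ?mem_head// => z; rewrite inE => /predU1P[->//|/yP zy].
  exact: le_trans le.
exists y; rewrite 1?inE ?ys ?orbT// => z; rewrite inE => /predU1P[->|].
  exact: ltW.
exact: yP.
Qed.

(** The ancestor at level [m] of a point [w] of the net of level [m + j]. *)
Fixpoint ancestor (T : Type) (parent : nat -> T -> T) (m j : nat) (w : T) : T :=
  if j is j'.+1 then parent m (ancestor parent m.+1 j' w) else w.

Definition descendants (T : choiceType) (N : nat -> seq T)
    (parent : nat -> T -> T) (m : nat) (u : T) : set T :=
  [set w | exists2 j, w \in N (m + j)%N & ancestor parent m j w = u].

(** Joining each net point to a nearest point of the previous net makes the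
    nets into a forest; the cube of [u] is the closure of the set of its
    descendants. *)
Section Cubes.
Context (R : realType) (X : metricType R).
Variables (c : R) (N : nat -> seq X) (parent : nat -> X -> X).
Let e m : R := c / 8 ^+ m.
Hypothesis c_gt0 : 0 < c.
Hypothesis N_nested : forall m, {subset N m <= N m.+1}.
Hypothesis N_separated : forall m, separated (e m / 2) (N m).
Hypothesis N_dense : forall m x, exists2 y, y \in N m & mdist x y <= e m.
Hypothesis parentN : forall m x, parent m x \in N m.
Hypothesis parent_nearest :
  forall m x z, z \in N m -> mdist x (parent m x) <= mdist x z.

Let cube m u := closure (descendants N parent m u).

Let e_gt0 m : 0 < e m. Proof. by rewrite /e divr_gt0// exprn_gt0. Qed.

Let eS m : e m.+1 = e m / 8.
Proof. by rewrite /e exprS invfM mulrCA mulrC. Qed.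

Let dist_ancestor j m w : mdist w (ancestor parent m j w) <= e m * (8 / 7).
Proof.
elim: j m => [|j IH] m /=; first by rewrite mdistxx; have := e_gt0 m; lra.
have [y yN] := N_dense m (ancestor parent m.+1 j w).
move=> /(le_trans (parent_nearest _ yN)) h.
have := metric_triangle w (ancestor parent m.+1 j w)
  (parent m (ancestor parent m.+1 j w)).
by have := IH m.+1; rewrite eS; lra.
Qed.

Let cube_radius m u x : cube m u x -> mdist u x <= 2 * e m.
Proof.
move=> cx; have e0 := e_gt0 m.
have [|w [j _ <-] xw] := closure_mdist cx (e := e m / 2); first lra.
have := metric_triangle (ancestor parent m j w) w x.
have := dist_ancestor j m w.
by rewrite (metric_sym w x) (metric_sym w (ancestor _ _ _ _)); lra.
Qed.

Let cube_cover m x : exists2 u, u \in N m & cube m u x.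
Proof.
suff : closure (cells (cube m) (N m)) x.
  rewrite -(closure_id _).1; first by move=> [u /= uN cu]; exists u.
  by apply: closed_cells => *; exact: closed_closure.
apply: (@closureS _ (\bigcup_j [set` N (m + j)%N])) => [w [j _ /= wN]|B].
  exists (ancestor parent m j w) => /=.
    case: j wN => [|j]/= ; first by rewrite addn0.
    by move=> _; exact: parentN.
  by apply: subset_closure; exists j.
move=> /metricType_numDomainType.nbhs_mdistP[d /= d0 dB].
have [j jd] : exists j, e (m + j) < d.
  have q1 : `|8^-1 : R| < 1 by rewrite ger0_norm; lra.
  have := cvg_expr q1 => /cvgrPdist_lt /(_ (d / c)); rewrite divr_gt0// => /(_ isT).
  move=> [j _ /(_ (m + j)%N)] /=; rewrite leq_addl sub0r normrN => /(_ isT).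
  rewrite ger0_norm ?exprn_ge0// exprVn ltr_pdivlMr// mulrC => h.
  by exists j; rewrite /e.
have [y yN xy] := N_dense (m + j) x.
by exists y; split; [exists j|apply: dB => /=; exact: le_lt_trans jd].
Qed.

(** A point near [u] cannot descend from another net point [v]: its ancestor
    at level [m.+1] is still closer to [u] than to [v], because the ratio 8 of
    the scales keeps the ancestors of higher levels within [e m / 7] of it, and
    the parent of that ancestor is a nearest one. *)
Let cube_contains_ball m u : u \in N m -> mcball u (e m / 10) `<=` cube m u.
Proof.
move=> uN x; rewrite /mcball /= => ux; have [v vN vx] := cube_cover m x.
have [<-//|vu] := eqVneq v u; exfalso; have e0 := e_gt0 m.
have [|w [j wN wv] xw] := closure_mdist vx (e := e m / 200); first lra.
have uw : mdist u w < e m * (21 / 200).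
  by have := metric_triangle u x w; lra.
have sepuv := N_separated vN uN vu.
case: j wN wv => [_ /= wv|j _ /= wv].
  by move: uw; rewrite wv metric_sym; lra.
set w' := ancestor parent m.+1 j w in wv.
have ww' : mdist w w' <= e m / 7.
  by have := dist_ancestor j m.+1 w; rewrite eS -/w'; lra.
have := parent_nearest w' uN; rewrite wv => w'v.
have := metric_triangle v w' u; rewrite (metric_sym v w') => tr1.
have := metric_triangle w' w u; rewrite (metric_sym w' w) (metric_sym w u).
by lra.
Qed.

Let cube_split m u :
  u \in N m -> cube m u = cells (cube m.+1) [seq v <- N m.+1 | parent m v == u].
Proof.
move=> uN; apply/seteqP; split.
  have -> : cells (cube m.+1) [seq v <- N m.+1 | parent m v == u] =
      closure (cells (cube m.+1) [seq v <- N m.+1 | parent m v == u]).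
    by apply/(closure_id _).1/closed_cells => *; exact: closed_closure.
  apply: closureS => w [[|j]] /=.
    rewrite addn0 => wN wu; exists u => /=; last first.
      by rewrite wu; apply: subset_closure; exists 0%N; rewrite ?addn0//; exact: N_nested.
    rewrite mem_filter N_nested// andbT eq_sym.
    apply/eqP/mdist_positivity/le_anti; rewrite mdist_ge0 andbT.
    by have := parent_nearest u uN; rewrite mdistxx.
  rewrite addnS -addSn => wN wu; exists (ancestor parent m.+1 j w) => /=.
    rewrite mem_filter wu eqxx /=.
    by case: j wN {wu} => [|j] /=; [rewrite addn0|move=> _; exact: parentN].
  by apply: subset_closure; exists j.
move=> x [v /=]; rewrite mem_filter => /andP[/eqP vu vN].
apply: closureS => w [j wN wv]; exists j.+1; first by rewrite addnS -addSn.
by rewrite /= wv.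
Qed.

Lemma cubes_of_nets :
  let cube m u := closure (descendants N parent m u) in
  [/\ forall m, cells (cube m) (N m) = setT,
      forall m u x, cube m u x -> mdist u x <= 2 * (c / 8 ^+ m),
      forall m u, u \in N m -> mcball u (c / 8 ^+ m / 10) `<=` cube m u &
      forall m u, u \in N m -> exists2 Z, {subset Z <= N m.+1} &
        cube m u = cells (cube m.+1) Z].
Proof.
split; [|exact: cube_radius|exact: cube_contains_ball|].
- move=> m; apply/seteqP; split => // x _.
  by have [u uN ux] := cube_cover m x; exists u.
- move=> m u uN; exists [seq v <- N m.+1 | parent m v == u].
    by move=> v; rewrite mem_filter => /andP[].
  exact: cube_split.
Qed.

End Cubes.

(** The clusters halve their radii at each level, but nearest parents need a
    larger ratio of scales, here 8; so the cubes of one scale serve for three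
    levels. *)
Lemma exists_nested_cubes (R : realType) (X : pmetricType R) (s : R) :
  compact [set: X] -> 0 < s ->
  exists (N : nat -> seq X) (C : nat -> X -> set X),
  [/\ forall k u, closed (C k u),
      forall k, cells (C k) (N k) = setT,
      forall k u x, C k u x -> mdist u x <= s / 2 ^+ k,
      forall k u, u \in N k -> mcball u (s / 2 ^+ k / 80) `<=` C k u &
      forall k u, u \in N k -> exists2 Z, {subset Z <= N k.+1} &
        C k u = cells (C k.+1) Z].
Proof.
move=> cX s0; pose c := s / 8; have c0 : 0 < c by rewrite divr_gt0.
have e0 m : 0 < c / 8 ^+ m by rewrite divr_gt0 ?exprn_gt0.
have /choice[ext extP] : forall p : nat * seq X, exists s',
    separated (c / 8 ^+ p.1 / 2) p.2 -> [/\ {subset p.2 <= s'},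
    separated (c / 8 ^+ p.1 / 2) s' &
    forall x, exists2 y, y \in s' & mdist x y <= c / 8 ^+ p.1].
  move=> [m s0'] /=.
  have [h|h] := pselect (separated (c / 8 ^+ m / 2) s0'); last by exists [::].
  by have [s' s'P] := separated_net_extend cX (e0 m) h; exists s'.
pose N := fix N m := ext (m, if m is m'.+1 then N m' else [::]).
have NE m : N m.+1 = ext (m.+1, N m) by [].
have [Nsep Ndense] : (forall m, separated (c / 8 ^+ m / 2) (N m)) /\
    forall m x, exists2 y, y \in N m & mdist x y <= c / 8 ^+ m.
  apply: all_and2; elim=> [|m [IH _]].
    by have [] := extP (0%N, [::]).
  have [] := extP (m.+1, N m) => //= x y xN yN xy.
  apply: le_lt_trans (IH _ _ xN yN xy).
  rewrite ler_pM2r// ler_pM2l// exprS invfM.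
  by rewrite ler_piMl ?invr_ge0 ?exprn_ge0//; lra.
have Nnest m : {subset N m <= N m.+1}.
  have [] := extP (m.+1, N m) => //= x y xN yN xy.
  apply: le_lt_trans (Nsep _ _ _ xN yN xy).
  rewrite ler_pM2r// ler_pM2l// exprS invfM.
  by rewrite ler_piMl ?invr_ge0 ?exprn_ge0//; lra.
have /choice[par parP] : forall p : nat * X, exists y, y \in N p.1 /\
    forall z, z \in N p.1 -> mdist p.2 y <= mdist p.2 z.
  move=> [m x]; have [|y yN yP] := seq_argmax (fun y => - mdist x y) (s := N m).
    by have [y yN _] := Ndense m x; apply/eqP => N0; rewrite N0 in yN.
  by exists y; split => // z /yP; rewrite lerN2.
pose parent m x := par (m, x).
have [cov rad bal spl] := cubes_of_nets c0 Nnest Nsep Ndense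
  (fun m x => (parP (m, x)).1) (fun m x => (parP (m, x)).2).
have pow8 k : 8 ^+ (k %/ 3) <= (2 : R) ^+ k <= 4 * 8 ^+ (k %/ 3).
  have -> : 8 = 2 ^+ 3 :> R by ring.
  rewrite -exprM {2 3}(divn_eq k 3) exprD (mulnC 3).
  have p0 : (0 : R) < 2 ^+ (k %/ 3 * 3) by rewrite exprn_gt0.
  have : 1 <= (2 : R) ^+ (k %% 3) <= 4.
    have : (k %% 3 < 3)%N by rewrite ltn_mod.
    by case: (k %% 3)%N => [|[|[|n]]] // _; rewrite ?expr0 ?expr1 ?expr2; lra.
  move: p0; set a := 2 ^+ _; set b := 2 ^+ _ => p0 /andP[b1 b4].
  by rewrite ler_peMr ?(ltW p0)//= mulrC ler_pM2r.
have scale k : s / 2 ^+ k / 8 <= c / 8 ^+ (k %/ 3) /\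
    2 * (c / 8 ^+ (k %/ 3)) <= s / 2 ^+ k.
  have /andP[h1 h2] := pow8 k.
  have p8 : 0 < (8 : R) ^+ (k %/ 3) by rewrite exprn_gt0.
  have p2 : 0 < (2 : R) ^+ k by rewrite exprn_gt0.
  move: h1 h2 p8 p2; rewrite /c; set a := 8 ^+ _; set b := 2 ^+ _ => h1 h2 a0 b0.
  split.
    by rewrite (mulrAC s) ler_pM2l ?divr_gt0// lef_pV2.
  have -> : 2 * (s / 8 / a) = s / (4 * a) by field; lra.
  by rewrite ler_pM2l// lef_pV2// posrE; lra.
pose cube m u := closure (descendants N parent m u).
exists (fun k => N (k %/ 3)%N), (fun k => cube (k %/ 3)%N); split.
- by move=> k u; exact: closed_closure.
- by move=> k; exact: cov.
- by move=> k u x /rad /le_trans; apply; exact: (scale k).2.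
- move=> k u uN x xu; apply: (bal _ _ uN); move: xu; rewrite /mcball /=.
  by move=> /le_trans; apply; have := (scale k).1; lra.
- move=> k u uN.
  have [->|->] : (k.+1 %/ 3 = k %/ 3 \/ k.+1 %/ 3 = (k %/ 3).+1)%N by lia.
    exists [:: u]; first by move=> v; rewrite inE => /eqP ->.
    apply/seteqP; split => x; first by exists u; rewrite //= mem_head.
    by move=> [v /=]; rewrite inE => /eqP ->.
  exact: spl.
Qed.

(** * Splitting a union of cells into separated pieces *)

Lemma diam_le (R : realType) (X : metricType R) (A : set X) (M : R) :
  0 <= M ->
  (diam A <= M%:E)%E <-> forall x y, A x -> A y -> mdist x y <= M.
Proof.
move=> M0; split=> [dA x y Ax Ay|dA].
  rewrite -lee_fin; apply: le_trans dA; apply: ereal_sup_ubound.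
  by right; exists x => //; exists y.
apply: ge_ereal_sup => _ [->|[x Ax [y Ay <-]]]; first by rewrite lee_fin.
by rewrite lee_fin dA.
Qed.

Lemma doubling_quarter (R : realType) (X : metricType R) (lambda : nat)
    (Z : set X) (M : R) :
  doubling X lambda -> 0 <= M ->
  (forall x y, Z x -> Z y -> mdist x y <= M) ->
  exists C : 'I_lambda * 'I_lambda -> set X, Z `<=` \bigcup_p C p /\
    forall p x y, C p x -> C p y -> mdist x y <= M / 4.
Proof.
move=> dX M0 ZM; have half (A : set X) (r : R) : 0 <= r ->
    (forall x y, A x -> A y -> mdist x y <= r) ->
    exists C : 'I_lambda -> set X, A `<=` \bigcup_i C i /\
    forall i x y, C i x -> C i y -> mdist x y <= r / 2.
  move=> r0 Ar; have [|C [AC dC]] := dX A; first by exists r.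
  exists C; split => // i; apply/diam_le; first by rewrite divr_ge0.
  apply: le_trans (dC i) _; rewrite mulrC EFinM.
  by rewrite lee_wpmul2l ?lee_fin ?invr_ge0//; apply/diam_le.
have [C [ZC CM]] := half Z M M0 ZM.
have /choice[D DP] : forall i, exists D : 'I_lambda -> set X,
    C i `<=` \bigcup_j D j /\
    forall j x y, D j x -> D j y -> mdist x y <= M / 2 / 2.
  by move=> i; apply: half; [rewrite divr_ge0|exact: CM].
exists (fun p => D p.1 p.2); split=> [x /ZC[i _ Cx]|p x y Dx Dy].
  by have [j _ Dx] := (DP i).1 x Cx; exists (i, j).
by have := (DP p.1).2 _ _ _ Dx Dy; lra.
Qed.

(** If all [t] steps multiplied [f] by more than [(b / a) `^ t^-1], it would
    exceed [b]. Negative powers are the form in which the bound telescopes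
    along the levels. *)
Lemma slow_step (R : realType) (t : nat) (f : nat -> R) (a b : R) :
  (0 < t)%N -> 0 < a -> 0 < b -> f 0%N = a -> f t <= b ->
  exists2 l, (l < t)%N &
    f l.+1 * b `^ (- t%:R^-1) <= f l * a `^ (- t%:R^-1).
Proof.
move=> t0 a0 b0 f0 ft; apply: contrapT => h.
have {h}fS l : (l < t)%N -> f l * a `^ (- t%:R^-1) < f l.+1 * b `^ (- t%:R^-1).
  by move=> lt; rewrite ltNge; apply/negP => le; apply: h; exists l.
have pow_t x : 0 < x -> (x `^ (- t%:R^-1)) ^+ t = x^-1.
  move=> x0; rewrite -powR_mulrn ?powR_ge0// -powRrM mulNr mulVf ?pnatr_eq0.
    by rewrite powR_inv1// ltW.
  by rewrite -lt0n.
have key l : (l < t)%N -> f 0%N * (a `^ (- t%:R^-1)) ^+ l.+1 <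
    f l.+1 * (b `^ (- t%:R^-1)) ^+ l.+1.
  elim: l => [/fS//|l IH lt]; have := IH (ltnW lt); have := fS _ lt.
  have aa : 0 < a `^ (- t%:R^-1) by rewrite powR_gt0.
  have bb : 0 < (b `^ (- t%:R^-1)) ^+ l.+1 by rewrite exprn_gt0// powR_gt0.
  move=> h1 h2; rewrite !(exprSr _ l.+1) !mulrA.
  apply: (@lt_trans _ _ (f l.+1 * b `^ (- t%:R^-1) ^+ l.+1 * a `^ (- t%:R^-1))).
    by rewrite ltr_pM2r.
  by rewrite mulrAC [ltRHS]mulrAC ltr_pM2r.
case: t t0 ft pow_t fS key => // t _ ft pow_t _ /(_ t (ltnSn t)).
rewrite !pow_t// f0 divff ?gt_eqF// ltNge => /negP; apply.
by rewrite ler_pdivrMr// mul1r.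
Qed.

(** The measure enters through its values on closed sets, where it is used as
    a monotone subadditive content. *)
Section Splitting.
Context (R : realType) (X : metricType R) (m : set X -> R).
Hypothesis m_set0 : m set0 = 0.
Hypothesis m_le : forall A B, closed A -> closed B -> A `<=` B -> m A <= m B.
Hypothesis m_setU :
  forall A B, closed A -> closed B -> m (A `|` B) <= m A + m B.

Let m_ge0 A : closed A -> 0 <= m A.
Proof. by move=> cA; rewrite -m_set0; apply: m_le => //; exact: closed0. Qed.

Let m_bigsetU (I : eqType) (s : seq I) (F : I -> set X) :
  (forall i, closed (F i)) ->
  m (\big[setU/set0]_(i <- s) F i) <= \sum_(i <- s) m (F i).
Proof.
move=> cF; elim: s => [|i s IH]; first by rewrite !big_nil m_set0.
rewrite !big_cons; apply: le_trans (m_setU _ _) _ => //.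
  by apply: closed_bigsetU => *; exact: cF.
by rewrite lerD2l.
Qed.

Variables (lambda : nat) (C : X -> set X) (e : R).
Hypothesis X_doubling : doubling X lambda.
Hypothesis e_gt0 : 0 < e.
Hypothesis C_closed : forall u, closed (C u).
Hypothesis C_radius : forall u x, C u x -> mdist u x <= e.

Let cQ Z : closed (cells C Z). Proof. by apply: closed_cells => *. Qed.

Let cQB Z x s : closed (cells C Z `&` mcball x s).
Proof. by apply: closedI => //; exact: closed_mcball. Qed.

#[local] Hint Resolve cQ cQB : core.

Let C_diam u x y : C u x -> C u y -> mdist x y <= 2 * e.
Proof.
move=> /C_radius ux /C_radius; have := metric_triangle x u y.
by rewrite (metric_sym x u); lra.
Qed.

(** The ball of radius [2 * r - 2 * e] has diameter [4 * (r - e)], so that it is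
    covered by [lambda ^ 2] sets of diameter [r - e]; each of them lies in the
    ball of radius [r] around the centre of a cell that it meets. *)
Lemma content_ball_doubling (Z : seq X) (r a : R) (x : X) :
  e <= r -> 0 <= a ->
  (forall u, u \in Z -> m (cells C Z `&` mcball u r) <= a) ->
  m (cells C Z `&` mcball x (2 * r - 2 * e)) <= lambda%:R ^+ 2 * a.
Proof.
move=> er a0 ma; set W := _ `&` _.
have [||D [WD Dd]] := @doubling_quarter _ _ _ W (4 * (r - e)) X_doubling.
- by lra.
- move=> y z [_ /= xy] [_ /= xz]; rewrite /mcball /= in xy xz.
  by have := metric_triangle y x z; rewrite (metric_sym y x); lra.
have /choice[F FP] : forall p, exists F : set X,
    [/\ closed F, m F <= a & D p `&` W `<=` F].
  move=> p; have [[z [Dz [[v /= vZ Cz] _]]]|h] := pselect (exists z, (D p `&` W) z).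
    exists (cells C Z `&` mcball v r); split => //; first exact: ma.
    move=> w [Dw [Zw _]]; split => //; rewrite /mcball /=.
    have := metric_triangle v z w; have := C_radius Cz.
    by have := Dd p z w Dz Dw; lra.
  exists set0; split; [exact: closed0|by rewrite m_set0|].
  by move=> z Wz; exfalso; apply: h; exists z.
pose I := index_enum ('I_lambda * 'I_lambda)%type.
apply: (@le_trans _ _ (m (\big[setU/set0]_(p <- I) F p))).
  apply: m_le => //; first exact: cQB.
    by apply: closed_bigsetU => p _; case: (FP p).
  move=> y Wy; have [p _ Dy] := WD y Wy; rewrite -bigcup_seq; exists p => /=.
    by rewrite mem_index_enum.
  by have [_ _] := FP p; apply.
apply: le_trans (m_bigsetU _ _) _; first by move=> p; case: (FP p).
apply: (@le_trans _ _ (\sum_(p <- I) a)).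
  by apply: ler_sum => p _; case: (FP p).
by rewrite sumr_const card_prod card_ord -[leLHS]mulr_natl natrM expr2.
Qed.

Variable t : nat.
Hypothesis t_gt0 : (0 < t)%N.
Let r : R := 16 * t%:R * e.

(** One cluster is carved out around the centre whose ball of radius [r] has
    the largest content [a]. Between the radii [r] and [2 * r - 2 * e] there
    are [t] rings, and a thin one, chosen by [slow_step], is discarded, so
    that the content of what is removed exceeds that of the cluster by a
    factor at most [(alpha / a) `^ t^-1] only. Maximality of [a] makes it an
    admissible [alpha] for the cluster at the next, halved, scale. *)
Lemma split_cells (alpha : R) (Z : seq X) :
  0 < alpha -> (forall u, u \in Z -> C u u) ->
  (forall x, cells C Z x ->
    m (cells C Z `&` mcball x (2 * r - 2 * e)) <= alpha) ->
  exists L : seq (seq X * R), [/\ uniq L,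
    forall q, q \in L ->
      [/\ {subset q.1 <= Z}, q.1 != [::],
          0 < q.2 <= m (cells C q.1) /\ m (cells C q.1) <= lambda%:R ^+ 2 * q.2,
          forall x y, cells C q.1 x -> cells C q.1 y -> mdist x y <= 4 * r &
          forall x, cells C q.1 x ->
            m (cells C q.1 `&` mcball x (r - e)) <= q.2],
    forall q q', q \in L -> q' \in L -> q != q' ->
      forall x y, cells C q.1 x -> cells C q'.1 y -> 8 * e <= mdist x y &
    m (cells C Z) * alpha `^ (- t%:R^-1) <=
      \sum_(q <- L) m (cells C q.1) * q.2 `^ (- t%:R^-1)].
Proof.
move=> alpha0; have e0 := e_gt0; have t1 : 1 <= t%:R :> R by rewrite ler1n.
have re : 16 * e <= r.
  by rewrite /r mulrAC ler_peMr// mulr_ge0// ltW.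
have [h th] : exists h, t%:R * h = r - 2 * e.
  by exists ((r - 2 * e) / t%:R); rewrite mulrC divfK// gt_eqF//; lra.
have h14 : 14 * e <= h.
  have te : e <= t%:R * e by rewrite ler_peMl// ltW.
  rewrite -(@ler_pM2l _ t%:R) ?(lt_le_trans ltr01)// th /r.
  have -> : t%:R * (14 * e) = 14 * (t%:R * e) by ring.
  by rewrite -mulrA; lra.
have lh l : (l < t)%N -> l%:R * h + h <= r - 2 * e.
  move=> lt; have : l%:R + 1 <= t%:R :> R by rewrite natr1 ler_nat.
  move=> lt1; rewrite -th -{2}[h]mul1r -mulrDl ler_wpM2r//; lra.
have [n] := ubnP (size Z); elim: n Z => // n IH Z; rewrite ltnS => sZ CZ mZ.
have [Z0|Z0] := eqVneq Z [::].
  exists [::]; split => //; rewrite big_nil Z0.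
  suff -> : cells C [::] = set0 by rewrite m_set0 mul0r.
  by apply/seteqP; split => // x [u].
have [x xZ xmax] := seq_argmax (fun u => m (cells C Z `&` mcball u r)) Z0.
set a := m _ in xmax.
(* balls of radius r around the centres cover, so nothing of positive content
   remains *)
have [a0|a0] := leP a 0.
  exists [::]; split => //; rewrite big_nil.
  rewrite mulr_le0_ge0 ?powR_ge0//.
  apply: (@le_trans _ _ (m (\big[setU/set0]_(u <- Z) (cells C Z `&` mcball u r)))).
    apply: m_le => //; first by apply: closed_bigsetU => *; exact: cQB.
    move=> y Zy; have [u /= uZ uy] := Zy; rewrite -bigcup_seq; exists u => //.
    by split=> //; rewrite /mcball /=; have := C_radius uy; lra.
  apply: le_trans (m_bigsetU _ _) _; first by move=> *; exact: cQB.
  by rewrite big_seq; apply: sumr_le0 => u uZ; apply: le_trans (xmax u uZ) _.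
have Zx : cells C Z x by exists x => //; exact: CZ.
pose f l := m (cells C Z `&` mcball x (r + l%:R * h)).
have [||l lt fl] := @slow_step _ t f a alpha t_gt0 a0 alpha0.
- by rewrite /f mul0r addr0.
- by rewrite /f th; have := mZ x Zx; congr (m (_ `&` mcball x _) <= _); lra.
have lht := lh _ lt; have lh0 : 0 <= l%:R * h by rewrite mulr_ge0//; lra.
have flE : f l.+1 = m (cells C Z `&` mcball x (r + l%:R * h + h)).
  by rewrite /f -addrA -[l.+1]addn1 natrD mulrDl mul1r.
pose inD u := `[< C u `<=` mcball x (r + l%:R * h + h) >].
pose Q := [seq u <- Z | `[< C u `&` mcball x (r + l%:R * h) !=set0 >]].
pose D := [seq u <- Z | inD u].
pose Z' := [seq u <- Z | ~~ inD u].
have QZ : {subset Q <= Z} by move=> u; rewrite mem_filter => /andP[].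
have Z'Z : {subset Z' <= Z} by move=> u; rewrite mem_filter => /andP[].
have sZ' : (size Z' < n)%N.
  apply: leq_trans sZ; rewrite size_filter -(count_predC inD Z) -[ltnLHS]add0n.
  rewrite ltn_add2r -has_count.
  apply/hasP; exists x => //; apply/asboolP => y /C_radius xy.
  by rewrite /mcball /=; lra.
have [||L' [uL' propL' gapL' sumL']] := IH Z' sZ'.
- by move=> u /Z'Z; exact: CZ.
- move=> y Z'y; have Zy := cells_sub Z'Z Z'y.
  by apply: le_trans (mZ y Zy); apply: m_le => //; apply: setSI; exact: cells_sub.
have xQ : x \in Q.
  rewrite mem_filter xZ andbT; apply/asboolP; exists x; split; first exact: CZ.
  by rewrite /mcball /= mdistxx; lra.
have Qball y : cells C Q y -> mdist x y <= r + l%:R * h + 2 * e.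
  move=> [u /=]; rewrite mem_filter => /andP[/asboolP[z [uz xz]] _] uy.
  have := metric_triangle x z y; have := C_diam uz uy.
  by move: xz; rewrite /mcball /=; lra.
have Z'ball z : cells C Z' z -> r + l%:R * h + h - 2 * e < mdist x z.
  move=> [u /=]; rewrite mem_filter => /andP[uD _] uz.
  rewrite ltNge; apply: contra uD => xz; apply/asboolP => w uw.
  have := metric_triangle x z w; have := C_diam uz uw.
  by rewrite /mcball /=; lra.
have gapQ y z : cells C Q y -> cells C Z' z -> 8 * e <= mdist y z.
  move=> /Qball xy /Z'ball xz; have := metric_triangle x y z; lra.
have fQ : f l <= m (cells C Q).
  apply: m_le => // y [[u /= uZ uy] xy]; exists u => //=.
  by rewrite mem_filter uZ andbT; apply/asboolP; exists y.
have aQ : a <= m (cells C Q).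
  apply: m_le => // y [[u /= uZ uy] xy]; exists u => //=.
  rewrite mem_filter uZ andbT; apply/asboolP; exists y; split => //.
  by move: xy; rewrite /mcball /=; lra.
have Qa : m (cells C Q) <= lambda%:R ^+ 2 * a.
  apply: le_trans (@content_ball_doubling Z r a x _ (ltW a0) xmax); last lra.
  apply: m_le => // y Qy; split; first exact: (cells_sub QZ).
  by rewrite /mcball /=; have := Qball _ Qy; lra.
exists ((Q, a) :: L'); split.
- (* the centre of the new cluster is at positive distance from the others *)
  rewrite /= uL' andbT; apply/negP => /propL'[QZ' _ _ _ _].
  have := gapQ x x; rewrite mdistxx => gap.
  suff : 8 * e <= 0 by lra.
  by apply: gap; exists x; [exact: xQ|exact: CZ|exact: QZ'|exact: CZ].
- move=> q; rewrite inE => /predU1P[-> /=|/propL'[h1 h2 h3 h4 h5]]; last first.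
    by split => // u /h1; exact: Z'Z.
  split => //.
  + by apply/eqP => Q0; rewrite Q0 in xQ.
  + by rewrite a0 aQ.
  + move=> y z /Qball xy /Qball xz; have := metric_triangle y x z.
    by rewrite (metric_sym y x); lra.
  + move=> y Qy; have [v /= /QZ vZ vy] := Qy.
    apply: le_trans (xmax v vZ); apply: m_le => // z [Qz yz].
    split; first exact: (cells_sub QZ).
    have := metric_triangle v y z; have := C_radius vy.
    by move: yz; rewrite /mcball /=; lra.
- move=> q q'; rewrite !inE.
  move=> /predU1P[->|qL] /predU1P[->|q'L] qq' y z; first by rewrite eqxx in qq'.
  + have [sub _ _ _ _] := propL' _ q'L => /= Qy q'z.
    by apply: gapQ Qy _; exact: cells_sub q'z.
  + have [sub _ _ _ _] := propL' _ qL => /= qy Qz.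
    by rewrite metric_sym; apply: gapQ Qz _; exact: cells_sub qy.
  + exact: gapL'.
- rewrite big_cons /=; apply: le_trans (lerD (lexx _) sumL').
  apply: (@le_trans _ _ ((m (cells C D) + m (cells C Z')) * alpha `^ (- t%:R^-1))).
    rewrite ler_wpM2r ?powR_ge0//; apply: le_trans (m_setU _ _) => //.
    apply: m_le => //; first exact: closedU.
    move=> y [u /= uZ uy]; have [uD|uD] := boolP (inD u); [left|right];
      by exists u; rewrite //= mem_filter uZ ?uD.
  rewrite mulrDl lerD2r; apply: (@le_trans _ _ (f l * a `^ (- t%:R^-1))).
    apply: le_trans fl; rewrite ler_wpM2r ?powR_ge0// flE; apply: m_le => //.
    move=> y [u /=]; rewrite mem_filter => /andP[/asboolP uD uZ] uy.
    by split; [exists u|exact: uD].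
  by rewrite ler_wpM2r ?powR_ge0.
Qed.

End Splitting.

(** * A tree of pieces carrying masses *)

(** Take [J] of total weight at least [n] from which no element can be removed.
    If it has two elements, then its weight is less than [2 * n], so that
    rescaling to the total [n] loses less than a factor 2; a single element
    receives all of [n]. A loss at one level is not passed on to the next one:
    in the first case the mass is compared with the weight itself, in the
    second one with the mass of the parent. *)
Lemma balanced_sublist (R : realType) (T : eqType) (w : T -> R) (L : seq T)
    (n : R) :
  uniq L -> (forall q, q \in L -> 0 < w q) -> 0 < n <= \sum_(q <- L) w q ->
  exists (J : seq T) (v : T -> R),
    [/\ uniq J, {subset J <= L}, \sum_(q <- J) v q = n &
        forall q, q \in J -> 0 < v q <= w q /\ (w q / 2 <= v q \/ v q = n)].
Proof.
move=> uL wL /andP[n0 nL].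
have [J [uJ JL nJ minJ]] : exists J : seq T, [/\ uniq J, {subset J <= L},
    n <= \sum_(q <- J) w q &
    forall q, q \in J -> \sum_(q' <- J) w q' - w q < n].
  have [k] := ubnP (size L); elim: k L uL {wL} nL => // k IH L uL nL sL.
  have [[q qL nq]|h] :=
      pselect (exists2 q, q \in L & n <= \sum_(q' <- L) w q' - w q).
    have [||J [uJ JL nJ minJ]] := IH (rem q L) (rem_uniq q uL).
    - by move: nq; rewrite [X in _ <= X - _](big_rem q)//= addrAC subrr add0r.
    - by rewrite size_rem// -ltnS prednK//; case: (L) qL.
    by exists J; split => // x /JL; exact: mem_rem.
  exists L; split => // q qL; rewrite ltNge; apply/negP => le.
  by apply: h; exists q.
have w0 q : q \in J -> 0 < w q by move=> /JL; exact: wL.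
have s0 : 0 < \sum_(q <- J) w q := lt_le_trans n0 nJ.
exists J, (fun q => w q * (n / \sum_(q' <- J) w q')); split => //.
  by rewrite -mulr_suml mulrC divfK// gt_eqF.
have ratio_le1 : n / \sum_(q' <- J) w q' <= 1 by rewrite ler_pdivrMr// mul1r.
move=> q qJ; split.
  by rewrite mulr_gt0 ?divr_gt0 ?w0//= ler_piMr// ltW// w0.
case: J => [//|q1 [|q2 J]] in uJ JL nJ minJ w0 s0 ratio_le1 qJ *.
  right; move: qJ s0; rewrite big_seq1 inE => /eqP -> s0.
  by rewrite mulrC divfK// gt_eqF.
left; rewrite ler_pM2l ?w0// ler_pdivlMr//.
have := minJ q1 (mem_head _ _); have := minJ q2; rewrite !inE eqxx orbT.
move=> /(_ isT); rewrite !big_cons; set s := \sum_(_ <- J) _ => h1 h2.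
suff : 0 <= s by lra.
by rewrite /s big_seq sumr_ge0// => x xJ; rewrite ltW// w0// !inE xJ !orbT.
Qed.

(** A piece of [X] together with the interval [[left, left + mass[]: the
    measure will be the image of Lebesgue measure under a map sending the
    interval of each node into its piece. *)
Record node (X R : Type) := Node { piece : set X; left : R; mass : R }.

HB.instance Definition _ (X R : Type) := gen_eqMixin (node X R).
HB.instance Definition _ (X R : Type) := gen_choiceMixin (node X R).

Section Nodes.
Context (R : realType) (X : Type).

Definition covers (a : node X R) (u : R) : bool :=
  left a <= u < left a + mass a.

Definition apart_intervals (a b : node X R) : bool :=
  (left a + mass a <= left b) || (left b + mass b <= left a).

Lemma covers_apart (a b : node X R) (u : R) :
  covers a u -> covers b u -> ~~ apart_intervals a b.
Proof.
rewrite /covers /apart_intervals negb_or -!ltNge => /andP[? ?] /andP[? ?].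
by apply/andP; split; lra.
Qed.

Variables (T : eqType) (Q : T -> set X) (v : T -> R).

Fixpoint place (o : R) (J : seq T) : seq (node X R) :=
  if J is q :: J' then Node (Q q) o (v q) :: place (o + v q) J' else [::].

Lemma placeP (o : R) (J : seq T) (a : node X R) :
  (forall q, q \in J -> 0 < v q) -> a \in place o J ->
  exists q, [/\ q \in J, piece a = Q q, mass a = v q, o <= left a &
    left a + mass a <= o + \sum_(q' <- J) v q'].
Proof.
elim: J o => // q J IH o v0 /=.
have v0J : forall q', q' \in J -> 0 < v q'.
  by move=> q' q'J; rewrite v0// inE q'J orbT.
have vq0 : 0 < v q by rewrite v0 ?mem_head.
have sJ : 0 <= \sum_(q' <- J) v q'.
  by rewrite big_seq sumr_ge0// => q' /v0J/ltW.
rewrite inE big_cons => /predU1P[->|aJ].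
  by exists q; rewrite /= mem_head; split => //; lra.
have [q' [q'J h1 h2 h3 h4]] := IH _ v0J aJ.
by exists q'; rewrite inE q'J orbT; split => //; lra.
Qed.

Lemma place_covers (o : R) (J : seq T) (u : R) :
  o <= u < o + \sum_(q <- J) v q -> exists2 a, a \in place o J & covers a u.
Proof.
elim: J o => [|q J IH] o; first by rewrite big_nil addr0 => /andP[]; lra.
rewrite big_cons /= => /andP[ou uo]; have [lt|le] := ltP u (o + v q).
  by exists (Node (Q q) o (v q)); rewrite ?mem_head// /covers /= ou lt.
have [|a aJ au] := IH (o + v q); first by rewrite le -addrA uo.
by exists a => //; rewrite inE aJ orbT.
Qed.

Lemma place_apart (o : R) (J : seq T) (a b : node X R) :
  uniq J -> (forall q, q \in J -> 0 < v q) ->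
  a \in place o J -> b \in place o J -> a != b ->
  apart_intervals a b /\ exists q q', [/\ q \in J, q' \in J, q != q',
    piece a = Q q & piece b = Q q'].
Proof.
elim: J o => // q J IH o /= /andP[qJ uJ] v0.
have v0J : forall q', q' \in J -> 0 < v q'.
  by move=> q' q'J; rewrite v0// inE q'J orbT.
have after c : c \in place (o + v q) J -> o + v q <= left c /\
    exists q', [/\ q' \in J, q != q' & piece c = Q q'].
  move=> /(placeP v0J)[q' [q'J h1 _ h3 _]]; split => //; exists q'; split => //.
  by apply: contraNneq qJ => ->.
rewrite !inE => /predU1P[->|aJ] /predU1P[->|bJ] ab.
- by rewrite eqxx in ab.
- have [ob [q' [q'J qq' bQ]]] := after _ bJ.
  split; first by rewrite /apart_intervals /= ob.
  by exists q, q'; rewrite !inE eqxx q'J orbT; split.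
- have [oa [q' [q'J qq' aQ]]] := after _ aJ.
  split; first by rewrite /apart_intervals /= oa orbT.
  by exists q', q; rewrite !inE eqxx q'J orbT eq_sym; split.
- have [h1 [q1 [q2 [q1J q2J q12 aQ bQ]]]] := IH _ uJ v0J aJ bJ ab.
  by split => //; exists q1, q2; rewrite !inE q1J q2J !orbT.
Qed.

End Nodes.

Lemma mul_powR_neg (R : realType) (x s : R) :
  0 < x -> x * x `^ (- s) = x `^ (1 - s).
Proof.
move=> x0; rewrite powRD; last by rewrite (gt_eqF x0) implybT.
by rewrite powRr1// ltW.
Qed.

Lemma powR_neg_le (R : realType) (x y s : R) :
  0 <= s -> 0 < x -> x <= y -> y `^ (- s) <= x `^ (- s).
Proof.
move=> s0 x0 xy; have y0 := lt_le_trans x0 xy.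
rewrite !powRN lef_pV2 ?posrE ?powR_gt0//.
by apply: ge0_ler_powR => //; rewrite nnegrE ltW.
Qed.

Section Tree.
Context (R : realType) (X : metricType R) (m : set X -> R).
Hypothesis m_set0 : m set0 = 0.
Hypothesis m_le : forall A B, closed A -> closed B -> A `<=` B -> m A <= m B.
Hypothesis m_setU :
  forall A B, closed A -> closed B -> m (A `|` B) <= m A + m B.
Hypothesis m_setT : m setT = 1.

Variables (lambda t : nat) (e0 : R) (N : nat -> seq X) (C : nat -> X -> set X).
Hypothesis t_gt0 : (0 < t)%N.
Hypothesis e0_gt0 : 0 < e0.
Hypothesis X_doubling : doubling X lambda.
Hypothesis lambda_gt0 : (0 < lambda)%N.
Hypothesis C_closed : forall k u, closed (C k u).
Hypothesis C_cover : forall k, cells (C k) (N k) = setT.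
Hypothesis C_radius : forall k u x, C k u x -> mdist u x <= e0 / 2 ^+ k.
Hypothesis C_ball :
  forall k u, u \in N k -> mcball u (e0 / 2 ^+ k / 80) `<=` C k u.
Hypothesis C_split : forall k u, u \in N k ->
  exists2 Z, {subset Z <= N k.+1} & C k u = cells (C k.+1) Z.
Hypothesis X_diam : forall x y : X, mdist x y <= 64 * t%:R * e0.
Hypothesis X_inhabited : exists x : X, True.

Let e k := e0 / 2 ^+ k.
Let e_gt0 k : 0 < e k. Proof. by rewrite /e divr_gt0// exprn_gt0. Qed.
Let eS k : e k = 2 * e k.+1.
Proof.
rewrite /e exprS; have : 0 < (2 : R) ^+ k by rewrite exprn_gt0.
by move=> h; field; rewrite gt_eqF.
Qed.
Let p : R := 1 - t%:R^-1.

Let p_ge0 : 0 <= p.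
Proof. by rewrite /p subr_ge0 invf_le1 ?ltr0n// ler1n. Qed.

Let cQ k Z : closed (cells (C k) Z). Proof. by apply: closed_cells => *. Qed.
#[local] Hint Resolve cQ : core.

Let refine_cells k Y : {subset Y <= N k} ->
  exists2 Z, {subset Z <= N k.+1} & cells (C k) Y = cells (C k.+1) Z.
Proof.
elim: Y => [|u Y IH] YN.
  by exists [::] => //; apply/seteqP; split => x [v].
have [Z1 Z1N uZ1] : exists2 Z, {subset Z <= N k.+1} & C k u = cells (C k.+1) Z.
  by apply: C_split; rewrite YN ?mem_head.
have [Z2 Z2N YZ2] : exists2 Z, {subset Z <= N k.+1} &
    cells (C k) Y = cells (C k.+1) Z.
  by apply: IH => v vY; rewrite YN// inE vY orbT.
exists (Z1 ++ Z2) => [v|].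
  by rewrite mem_cat => /orP[/Z1N|/Z2N].
have -> : cells (C k) (u :: Y) = C k u `|` cells (C k) Y.
  apply/seteqP; split => x.
    by move=> [v /=]; rewrite inE => /predU1P[->|vY] vx; [left|right; exists v].
  case=> [ux|[v /= vY vx]]; first by exists u; rewrite //= mem_head.
  by exists v; rewrite //= inE vY orbT.
rewrite uZ1 YZ2; apply/seteqP; split => x.
  by case=> -[v /= vZ vx]; exists v => //=; rewrite mem_cat vZ ?orbT.
by move=> [v /=]; rewrite mem_cat => /orP[]vZ vx; [left|right]; exists v.
Qed.

(** The weight [m Q * a `^ (- t^-1)] is the largest mass that [Q] may carry; it
    lies between [m Q `^ p] and [lambda `^ (2 / t)] times that, by the bounds
    on [a]. As [16 * t * e k - e k] is [2 * r - 2 * e] for the scale of level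
    [k.+1], the bound on balls is the hypothesis under which splitting [Q] does
    not decrease the total weight. *)
Definition admissible (k : nat) (Q : set X) (n : R) := exists (Z : seq X) (a : R),
  [/\ {subset Z <= N k} /\ Z != [::], Q = cells (C k) Z,
      0 < a <= m Q /\ m Q <= lambda%:R ^+ 2 * a,
      (forall x y, Q x -> Q y -> mdist x y <= 64 * t%:R * e k) /\
      (forall x, Q x -> m (Q `&` mcball x (16 * t%:R * e k - e k)) <= a) &
      0 < n /\ m Q `^ p / 2 <= n <= m Q * a `^ (- t%:R^-1)].

Let children k (a : node X R) : admissible k (piece a) (mass a) ->
  exists L : seq (node X R), [/\
    forall b, b \in L -> [/\ admissible k.+1 (piece b) (mass b),
      piece b `<=` piece a, left a <= left b &
      left b + mass b <= left a + mass a],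
    forall b c, b \in L -> c \in L -> b != c -> apart_intervals b c /\
      forall x y, piece b x -> piece c y -> 8 * e k.+1 <= mdist x y &
    forall u, covers a u -> exists2 b, b \in L & covers b u].
Proof.
move=> [Y [al [[YN Y0] aY [/andP[al0 alQ] Qal] [Qdiam Qball] [n0 /andP[nlow nup]]]]].
have [Z ZN YZ] := refine_cells YN.
have [||L [uL propL gapL sumL]] := @split_cells R X m m_set0 m_le m_setU
    lambda (C k.+1) (e k.+1) X_doubling (e_gt0 k.+1) (@C_closed k.+1)
    (@C_radius k.+1) t t_gt0 al Z al0.
- move=> u /ZN uN; apply: (C_ball uN); apply: mcball_center.
  by rewrite divr_ge0// ltW// e_gt0.
- rewrite -YZ -aY => x Qx; have := Qball x Qx.
  by rewrite eS; congr (m (_ `&` mcball x _) <= _); ring.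
have wL q : q \in L -> 0 < m (cells (C k.+1) q.1) * q.2 `^ (- t%:R^-1).
  move=> /propL[_ _ [/andP[q0 qm] _] _ _].
  by rewrite mulr_gt0 ?powR_gt0// (lt_le_trans q0).
have [|J [v [uJ JL sumv vP]]] := balanced_sublist (n := mass a) uL wL.
  by rewrite n0 (le_trans nup)// aY YZ.
have v0 q : q \in J -> 0 < v q by move=> /vP[/andP[]].
exists (place (fun q => cells (C k.+1) q.1) v (left a) J); split.
- move=> b /(placeP v0)[q [qJ bQ bv h1 h2]].
  have [qZ qnil [/andP[q0 qm] mq] qdiam qball] := propL _ (JL _ qJ).
  have [/andP[_ vw] vlow] := vP q qJ.
  have QP : cells (C k.+1) q.1 `<=` piece a by rewrite aY YZ; exact: cells_sub.
  have mQ0 := lt_le_trans q0 qm.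
  split; rewrite ?bQ//; last by rewrite -sumv.
  exists q.1, q.2; split => //.
  + by split => // u /qZ/ZN.
  + by rewrite q0 qm.
  + split => [x y Qx Qy|//]; apply: le_trans (qdiam x y Qx Qy) _.
    by rewrite !mulrA; lra.
  + rewrite bv; split; [exact: v0|rewrite vw andbT].
    (* a rescaled child is compared with its own weight, an only child with
       its parent *)
    case: vlow => [|->].
      apply: le_trans; rewrite ler_pM2r ?invr_gt0// -mul_powR_neg//.
      by rewrite ler_pM2l// powR_neg_le.
    apply: le_trans nlow; rewrite ler_pM2r ?invr_gt0//.
    apply: ge0_ler_powR; rewrite ?nnegrE//; try exact: ltW.
      by rewrite ltW// (lt_le_trans al0).
    by apply: m_le; rewrite // aY.
- move=> b c bL cL bc.
  have [apart [q [q' [qJ q'J qq' -> ->]]]] := place_apart uJ v0 bL cL bc.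
  by split => // x y; apply: gapL => //; exact: JL.
- by move=> u au; apply: place_covers; rewrite sumv.
Qed.

(** The node at the root is the whole space with the unit interval. Children
    subdivide the interval of their parent, so that at each level the intervals
    partition [[0, 1[]. *)
Lemma exists_node_tree : exists T : nat -> seq (node X R), [/\
  forall k a, a \in T k -> [/\ closed (piece a),
    forall x y, piece a x -> piece a y -> mdist x y <= 64 * t%:R * (e0 / 2 ^+ k),
    exists u, mcball u (e0 / 2 ^+ k / 80) `<=` piece a,
    0 < mass a &
    m (piece a) `^ p / 2 <= mass a <= lambda%:R `^ (2 / t%:R) * m (piece a) `^ p],
  T 0%N = [:: Node setT 0 1],
  forall k u, 0 <= u < 1 -> exists2 a, a \in T k & covers a u,
  forall k a b, a \in T k -> b \in T k -> a != b -> apart_intervals a b /\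
    forall x y, piece a x -> piece b y -> 8 * (e0 / 2 ^+ k) <= mdist x y &
  forall k b, b \in T k.+1 -> exists a, [/\ a \in T k, piece b `<=` piece a,
    left a <= left b & left b + mass b <= left a + mass a]].
Proof.
have /choice[ch chP] : forall ka : nat * node X R,
    exists L : seq (node X R),
    admissible ka.1 (piece ka.2) (mass ka.2) -> [/\
    forall b, b \in L -> [/\ admissible ka.1.+1 (piece b) (mass b),
      piece b `<=` piece ka.2, left ka.2 <= left b &
      left b + mass b <= left ka.2 + mass ka.2],
    forall b c, b \in L -> c \in L -> b != c -> apart_intervals b c /\
      forall x y, piece b x -> piece c y -> 8 * e ka.1.+1 <= mdist x y &
    forall u, covers ka.2 u -> exists2 b, b \in L & covers b u].
  move=> [k a] /=; have [ga|ga] := pselect (admissible k (piece a) (mass a)).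
    by have [L LP] := children ga; exists L.
  by exists [::].
pose T := fix T k := if k is k'.+1 then
  flatten [seq ch (k', a) | a <- T k'] else [:: Node setT 0 1].
have TS k b : b \in T k.+1 -> exists2 a, a \in T k & b \in ch (k, a).
  by move=> /flatten_mapP[a aT bc]; exists a.
have goodT k a : a \in T k -> admissible k (piece a) (mass a).
  elim: k a => [a|k IH b /TS[a /IH ga bc]]; last first.
    by have [h _ _] := chP (k, a) ga; have [] := h b bc.
  rewrite inE => /eqP -> /=; exists (N 0%N), 1; split.
  - split => //; apply/eqP => N0; have [x _] := X_inhabited.
    have : [set: X] x by [].
    by rewrite -(C_cover 0) N0 => -[].
  - by rewrite C_cover.
  - by rewrite m_setT ltr01 lexx mulr1 exprn_ege1// ler1n.
  - split => [x y _ _|x _]; first by rewrite /e expr0 divr1.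
    rewrite -m_setT; apply: m_le; [|exact: closedT|exact: subsetT].
    by apply: closedI; [exact: closedT|exact: closed_mcball].
  - by rewrite m_setT powR1 mulr1 ltr01 lexx andbT; split => //; lra.
exists T; split.
- move=> k a /goodT[Z [al [[ZN Z0] aZ [/andP[al0 alQ] Qal] [Qdiam _]]]].
  move=> [n0 /andP[nlow nup]]; split => //; first by rewrite aZ.
    case: Z Z0 ZN aZ => // u Z _ ZN ->; exists u => x /C_ball ux; exists u.
      by rewrite /= mem_head.
    by apply: ux; rewrite ZN ?mem_head.
  rewrite nlow; apply: le_trans nup _; have Q0 := lt_le_trans al0 alQ.
  have l0 : 0 < lambda%:R :> R by rewrite ltr0n.
  rewrite -(mul_powR_neg _ Q0) mulrCA ler_pM2l//.
  have -> : lambda%:R `^ (2 / t%:R) = (lambda%:R ^+ 2) `^ (t%:R^-1) :> R.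
    by rewrite -(@powR_mulrn _ lambda%:R 2) ?ltW// -powRrM.
  have l2 : 0 < lambda%:R ^+ 2 :> R by rewrite exprn_gt0.
  have -> : (lambda%:R ^+ 2) `^ t%:R^-1 = ((lambda%:R ^+ 2)^-1) `^ (- t%:R^-1) :> R.
    by rewrite -(@powR_inv1 _ (lambda%:R ^+ 2)) ?ltW// -powRrM mulN1r opprK.
  have l2V : 0 < (lambda%:R ^+ 2)^-1 :> R by rewrite invr_gt0.
  rewrite -powRM ?(ltW l2V) ?(ltW Q0)//; apply: powR_neg_le => //.
    by rewrite mulr_gt0.
  by rewrite mulrC ler_pdivrMr// mulrC.
- by [].
- elim=> [u u01|k IH u /IH[a aT au]].
    by exists (Node setT 0 1); rewrite ?mem_head// /covers /= add0r.
  have [_ _ /(_ u au)[b bc bu]] := chP (k, a) (goodT _ _ aT).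
  by exists b => //; apply/flatten_mapP; exists a.
- elim=> [a b|k IH b c]; first by rewrite !mem_seq1 => /eqP -> /eqP ->; rewrite eqxx.
  move=> /TS[a aT ba] /TS[a' a'T ca'] bc.
  have [ha hab _] := chP (k, a) (goodT _ _ aT).
  have [aa'|aa'] := eqVneq a a'; first by rewrite -aa' in ca'; exact: hab.
  have [ha' _ _] := chP (k, a') (goodT _ _ a'T).
  have [_ bsub b1 b2] := ha b ba; have [_ csub c1 c2] := ha' c ca'.
  have [apart gap] := IH _ _ aT a'T aa'; rewrite /= in bsub b1 b2 csub c1 c2.
  split.
    move: apart; rewrite /apart_intervals => /orP[] h; apply/orP; [left|right];
      lra.
  move=> x y /bsub ax /csub a'y; have := gap x y ax a'y.
  by rewrite -/(e k) eS -/(e k.+1); have := e_gt0 k.+1; lra.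
- move=> k b /TS[a aT bc]; exists a.
  by have [h _ _] := chP (k, a) (goodT _ _ aT); have [_ ? ? ?] := h b bc.
Qed.

End Tree.

(** * From nested equivalence relations to an ultrametric *)

(** The distance of two points is [D k] for the last level [k] at which they
    are equivalent. *)
Section Levels.
Context (R : realType) (X : metricType R) (S : set X).
Variables (E : nat -> X -> X -> Prop) (D : nat -> R) (c : R).
Hypothesis D_gt0 : forall k, 0 < D k.
Hypothesis D_anti : forall k j, (k <= j)%N -> D j <= D k.
Hypothesis D_small : forall d, 0 < d -> exists k, D k < d.
Hypothesis E_sym : forall k x y, E k x y -> E k y x.
Hypothesis E_trans : forall k x y z,
  S x -> S y -> S z -> E k x z -> E k z y -> E k x y.
Hypothesis E_anti : forall k j x y, (k <= j)%N -> E j x y -> E k x y.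
Hypothesis E_total : forall x y, S x -> S y -> E 0%N x y.
Hypothesis E_near : forall k x y, E k x y -> mdist x y <= D k.
Hypothesis E_far :
  forall k x y, S x -> S y -> ~ E k.+1 x y -> D k <= c * mdist x y.

Lemma embeds_of_levels : embeds_ultrametric S c.
Proof.
have lev x y : S x -> S y -> x != y -> exists k, forall j, E j x y <-> (j <= k)%N.
  move=> Sx Sy xy; have [n nD] := @D_small (mdist x y) ltac:(by rewrite mdist_gt0).
  have nE : exists n, `[< ~ E n x y >].
    by exists n; apply/asboolP => /E_near; rewrite leNgt nD.
  case: (ex_minnP nE) => -[/asboolP[]|k /asboolP kE kmin]; first exact: E_total.
  exists k => j; split=> [jE|jk].
    by rewrite leqNgt; apply/negP => kj; apply: kE; exact: E_anti jE.
  apply: (E_anti jk); apply: contrapT => kE'.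
  by have := kmin k; rewrite ltnn => /(_ ltac:(exact/asboolP)).
have /choice[rho rhoP] : forall p : X * X, exists r, (p.1 = p.2 -> r = 0) /\
    (S p.1 -> S p.2 -> p.1 != p.2 ->
     exists2 k, r = D k & forall j, E j p.1 p.2 <-> (j <= k)%N).
  move=> [x y] /=; have [<-|xy] := eqVneq x y.
    by exists 0; split => //; rewrite eqxx.
  have [[Sx Sy]|nS] := pselect (S x /\ S y); last first.
    by exists 0; split => // Sx Sy; case: nS.
  have [k kP] := lev x y Sx Sy xy.
  by exists (D k); split => [xy'|*]; [rewrite xy' eqxx in xy|exists k].
pose d x y := rho (x, y).
have d0 x : d x x = 0 by exact: (rhoP (x, x)).1.
have dP x y : S x -> S y -> x != y ->
    exists2 k, d x y = D k & forall j, E j x y <-> (j <= k)%N.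
  exact: (rhoP (x, y)).2.
have d_ge0 x y : S x -> S y -> 0 <= d x y.
  move=> Sx Sy; have [<-|xy] := eqVneq x y; first by rewrite d0.
  by have [k -> _] := dP x y Sx Sy xy; exact: ltW.
have d_sym x y : S x -> S y -> d x y = d y x.
  move=> Sx Sy; have [<-//|xy] := eqVneq x y.
  have [k -> kP] := dP x y Sx Sy xy.
  have [|j -> jP] := dP y x Sy Sx; first by rewrite eq_sym.
  congr D; apply/eqP; rewrite eqn_leq; apply/andP; split.
    by apply/jP/E_sym/kP.
  by apply/kP/E_sym/jP.
have d_ultra x y z : S x -> S y -> S z -> d x y <= Num.max (d x z) (d y z).
  move=> Sx Sy Sz; rewrite le_max.
  have [<-|xy] := eqVneq x y; first by rewrite d0 d_ge0.
  have [<-|xz] := eqVneq x z; first by rewrite (d_sym x)// lexx orbT.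
  have [<-|yz] := eqVneq y z; first by rewrite lexx.
  have [k -> kP] := dP x y Sx Sy xy.
  have [i -> iP] := dP x z Sx Sz xz; have [j -> jP] := dP y z Sy Sz yz.
  have ijk : (minn i j <= k)%N.
    apply/kP; apply: (@E_trans _ _ _ z) => //; first exact/iP/geq_minl.
    exact/E_sym/jP/geq_minr.
  by move: ijk; rewrite geq_min => /orP[] /D_anti ->; rewrite ?orbT.
exists d; split; [split; [split|exact: d_ultra]|].
- exact: d_ge0.
- move=> x y Sx Sy; split=> [|->]; last exact: d0.
  have [//|xy] := eqVneq x y; have [k -> _] := dP x y Sx Sy xy.
  by move=> Dk; have := D_gt0 k; rewrite Dk ltxx.
- exact: d_sym.
- move=> x y z Sx Sy Sz; apply: le_trans (d_ultra _ _ _ Sx Sy Sz) _.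
  by rewrite (d_sym z)// ge_max lerDl lerDr !d_ge0.
- move=> x y Sx Sy; have [<-|xy] := eqVneq x y.
    by rewrite d0 mdistxx mulr0 lexx.
  have [k -> kP] := dP x y Sx Sy xy; apply/andP; split.
    by apply/E_near/kP.
  by apply: E_far => // /kP; rewrite ltnn.
Qed.

End Levels.

Lemma ultrametric_distortion_le (R : realType) (X : metricType R) (S : set X)
    (c : R) :
  1 <= c -> embeds_ultrametric S c -> (ultrametric_distortion S <= c%:E)%E.
Proof. by move=> c1 Sc; apply: ereal_inf_lbound; exists c. Qed.

(** * Borel sets and the uniform distribution *)

Lemma measurable_open_borel (R : realType) (X : pmetricType R) (U : set X) :
  open U -> measurable (U : set (borel X)).
Proof. by move=> oU; exact: sub_sigma_algebra. Qed.

Lemma measurable_closed_borel (R : realType) (X : pmetricType R) (F : set X) :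
  closed F -> measurable (F : set (borel X)).
Proof.
move=> cF; rewrite -(setCK (F : set (borel X))); apply: measurableC.
by apply: measurable_open_borel; rewrite openC.
Qed.

Lemma measurable_mcball (R : realType) (X : pmetricType R) (x : X) (r : R) :
  measurable (mcball x r : set (borel X)).
Proof. by apply: measurable_closed_borel; exact: closed_mcball. Qed.

Lemma uniform_prob_itv (R : realType) (o n : R) :
  0 <= o -> 0 <= n -> o + n <= 1 ->
  uniform_prob (@ltr01 R) `[o, (o + n)[%classic = n%:E.
Proof.
move=> o0 n0 on1; rewrite /uniform_prob.
rewrite (eq_integral (fun=> 1%:E)); last first.
  move=> x; rewrite inE /= in_itv /= => /andP[ox xon].
  rewrite /uniform_pdf (le_trans o0 ox) (le_trans (ltW xon) on1) /=.
  by rewrite subr0 invr1.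
rewrite integral_cst//= mul1e lebesgue_measure_itv /= lte_fin ltrDl.
have [n0'|n0'] := ltP 0 n; first by rewrite -EFinD addrAC subrr add0r.
by congr (_%:E); apply/le_anti/andP.
Qed.

Lemma uniform_prob_le_itv (R : realType) (A : set R) (o n : R) :
  measurable A -> 0 <= o -> 0 <= n -> o + n <= 1 ->
  A `&` `[0, 1[%classic `<=` `[o, (o + n)[%classic ->
  (uniform_prob (@ltr01 R) A <= n%:E)%E.
Proof.
move=> mA o0 n0 on1 Asub; rewrite -(uniform_prob_itv o0 n0 on1).
pose P : probability (measurableTypeR R) R := uniform_prob (@ltr01 R).
have P01 : P (~` `[0, 1[%classic) = 0%E.
  rewrite probability_setC//.
  have P1 : P `[0, 1[%classic = 1%E.
    by have := @uniform_prob_itv R 0 1; rewrite add0r; apply.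
  by rewrite P1 -EFinB subrr.
rewrite -[leLHS]/(P A) -[leRHS]/(P `[o, (o + n)[%classic).
apply: (@le_trans _ _ (P (`[o, (o + n)[%classic `|` ~` `[0, 1[%classic))).
  apply: le_measure; rewrite ?inE//.
    by apply: measurableU => //; exact: measurableC.
  by move=> x Ax; have [x01|x01] := pselect (`[0, 1[%classic x);
    [left; apply: Asub|right].
apply: le_trans (measureU2 _ _ _) _ => //; first exact: measurableC.
by move: P01 => /= ->; rewrite adde0.
Qed.

(** * The measure carried by a tree of pieces *)

Section Limit.
Context (R : realType) (X : pmetricType R).
Variables (T : nat -> seq (node X R)) (D g : nat -> R).
Hypothesis X_compact : compact [set: X].
Hypothesis g_gt0 : forall k, 0 < g k.
Hypothesis D_small : forall d, 0 < d -> exists k, D k < d.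
Hypothesis T_closed : forall k a, a \in T k -> closed (piece a).
Hypothesis T_nonempty : forall k a, a \in T k -> exists x, piece a x.
Hypothesis T_diam :
  forall k a x y, a \in T k -> piece a x -> piece a y -> mdist x y <= D k.
Hypothesis T_mass : forall k a, a \in T k -> 0 <= mass a.
Hypothesis T_root : T 0%N = [:: Node setT 0 1].
Hypothesis T_covers :
  forall k u, 0 <= u < 1 -> exists2 a, a \in T k & covers a u.
Hypothesis T_apart : forall k a b, a \in T k -> b \in T k -> a != b ->
  apart_intervals a b /\ forall x y, piece a x -> piece b y -> g k <= mdist x y.
Hypothesis T_nested : forall k b, b \in T k.+1 ->
  exists a, [/\ a \in T k, piece b `<=` piece a, left a <= left b &
    left b + mass b <= left a + mass a].

Let T_unit k a : a \in T k -> 0 <= left a /\ left a + mass a <= 1.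
Proof.
elim: k a => [a|k IH b /T_nested[a [/IH[? ?] _ ? ?]]]; last by split; lra.
by rewrite T_root inE => /eqP -> /=; rewrite add0r.
Qed.

Let covers_inj k a b u :
  a \in T k -> b \in T k -> covers a u -> covers b u -> a = b.
Proof.
move=> aT bT au bu; apply/eqP; apply: contraT => /(T_apart aT bT)[h _].
by have := covers_apart au bu; rewrite h.
Qed.

Let piece_inj k a b x :
  a \in T k -> b \in T k -> piece a x -> piece b x -> a = b.
Proof.
move=> aT bT ax bx; apply/eqP; apply: contraT => /(T_apart aT bT)[_ h].
by have := h x x ax bx; rewrite mdistxx leNgt g_gt0.
Qed.

Let covers_unit k a u : a \in T k -> covers a u -> 0 <= u < 1.
Proof.
move=> /T_unit[h1 h2] /andP[h3 h4].
by rewrite (le_trans h1 h3) (lt_le_trans h4 h2).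
Qed.

(** The pieces whose intervals contain [u] decrease, and compactness gives
    them a common point. *)
Let limit_point u : 0 <= u < 1 ->
  exists x, forall k, exists a, [/\ a \in T k, covers a u & piece a x].
Proof.
move=> u01; have /choice[a aP] : forall k, exists a, a \in T k /\ covers a u.
  by move=> k; have [a aT au] := T_covers k u01; exists a.
have aS k : piece (a k.+1) `<=` piece (a k).
  have [b [bT sub h1 h2]] := T_nested (aP k.+1).1.
  suff -> : a k = b by [].
  apply: (covers_inj (aP k).1 bT (aP k).2).
  by have := (aP k.+1).2; rewrite /covers => /andP[? ?]; apply/andP; split; lra.
have aD k j : (k <= j)%N -> piece (a j) `<=` piece (a k).
  elim: j => [|j IH]; first by rewrite leqn0 => /eqP ->.
  by rewrite leq_eqVlt => /predU1P[->//|/IH h] x /aS /h.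
have /choice[x xP] : forall k, exists x, piece (a k) x.
  by move=> k; exact: T_nonempty (aP k).1.
have [z [_ zP]] := X_compact (F := x @ \oo) _ filterT.
exists z => k; exists (a k); split; [exact: (aP k).1|exact: (aP k).2|].
have cl := T_closed (aP k).1; rewrite ((closure_id _).1 cl) => B zB.
have xF : (x @ \oo) (piece (a k)).
  by exists k => // j /= kj; exact: (aD _ _ kj).
exact: zP xF zB.
Qed.

(** The map [f] sends a point of [[0, 1[] to the common point of the pieces
    whose intervals contain it. It is Borel: [f u] lies in an open set if and
    only if some piece whose interval contains [u] is included in it. *)
Lemma exists_tree_measure : exists (S : set X) (nu : probability (borel X) R),
  [/\ compact S, supported_on nu S,
    forall k y, S y -> exists2 a, a \in T k & piece a y,
    forall k a B, a \in T k -> measurable (B : set (borel X)) ->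
      piece a `<=` B -> ((mass a)%:E <= nu B)%E &
    forall k a B, a \in T k -> measurable (B : set (borel X)) ->
      S `&` B `<=` piece a -> (nu B <= (mass a)%:E)%E].
Proof.
have u01 : 0 <= (0 : R) < 1 by rewrite lexx ltr01.
have /choice[phi phiP] : forall u : R, exists x, 0 <= u < 1 -> forall k,
    exists a, [/\ a \in T k, covers a u & piece a x].
  move=> u; have [/limit_point[x xP]|h] := boolP (0 <= u < 1); first by exists x.
  by exists point.
pose f (u : R) := if 0 <= u < 1 then phi u else phi 0.
have fP u : 0 <= u < 1 -> forall k,
    exists a, [/\ a \in T k, covers a u & piece a (f u)].
  by move=> h; rewrite /f h; exact: phiP.
have fT u k : exists2 a, a \in T k & piece a (f u).
  rewrite /f; case: ifPn => [h|_].
    by have [a [aT _ ax]] := phiP u h k; exists a.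
  by have [a [aT _ ax]] := phiP 0 u01 k; exists a.
have mf : measurable_fun [set: measurableTypeR R] (f : _ -> borel X).
  apply: (@measurability _ _ (measurableTypeR R) (borel X) setT f (@open X)) => //.
  move=> _ [U oU <-]; rewrite setTI.
  have -> : f @^-1` U =
      (\bigcup_k \bigcup_(a in [set` [seq a <- T k | `[< piece a `<=` U >]]])
        `[left a, (left a + mass a)[%classic) `|`
      (if `[< U (phi 0) >] then ~` `[0, 1[%classic else set0).
    apply/seteqP; split => u /=.
      move=> Ufu; have [h|h] := boolP (0 <= u < 1); last first.
        right; move: Ufu; rewrite /f (negbTE h) => /asboolP -> /=.
        by rewrite in_itv /=; exact/negP.
      left; have [d /= d0 dU] := (metricType_numDomainType.nbhs_mdistP _ _).1
        (open_nbhs_nbhs (conj oU Ufu)).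
      have [k kd] := D_small d0; have [a [aT au ax]] := fP u h k.
      exists k => //; exists a; last by rewrite /= in_itv.
      rewrite /= mem_filter aT andbT; apply/asboolP => y ay; apply: dU => /=.
      exact: le_lt_trans (T_diam aT ax ay) kd.
    move=> [[k _ [a /=]]|].
      rewrite mem_filter in_itv /= => /andP[/asboolP aU aT] au.
      have [b [bT bu bx]] := fP u (covers_unit aT au) k.
      by apply: aU; rewrite (covers_inj aT bT au bu).
    case: ifPn => // /asboolP Uphi /=; rewrite in_itv /= => /negP h.
    by rewrite /f (negbTE h).
  apply: measurableU; last by case: ifPn => // _; exact: measurableC.
  apply: bigcup_measurable => k _; apply: fin_bigcup_measurable => //.
pose F : {mfun measurableTypeR R >-> borel X} :=
  HB.pack (f : measurableTypeR R -> borel X)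
    (isMeasurableFun.Build _ _ (measurableTypeR R) (borel X) f mf).
pose P : probability (measurableTypeR R) R := uniform_prob (@ltr01 R).
pose nu : probability (borel X) R := distribution P F.
pose S : set X := closure (range f).
have rangeS u : S (f u) by apply: subset_closure; exists u.
have mfB (B : set (borel X)) : measurable B -> measurable (f @^-1` B).
  by move=> mB; rewrite -[X in measurable X]setTI; exact: (mf measurableT _ mB).
exists S, nu; split.
- by apply: (subclosed_compact _ X_compact) => //; exact: closed_closure.
- rewrite /supported_on /nu /distribution /pushforward /=.
  have -> : f @^-1` (~` S) = set0.
    by apply/seteqP; split => // u; apply; exact: rangeS.
  exact: (measure0 P).
- move=> k y Sy; have : closure (cells (@piece X R) (T k)) y.
    apply: closureS Sy => _ [u _ <-].
    by have [a aT ax] := fT u k; exists a.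
  rewrite -((closure_id _).1 _); last by apply: closed_cells; exact: T_closed.
  by move=> [a /= aT ay]; exists a.
- move=> k a B aT mB aB; have [h1 h2] := T_unit aT.
  rewrite -(uniform_prob_itv h1 (T_mass aT) h2).
  apply: le_measure; rewrite ?inE//; first exact: mfB.
  move=> u; rewrite /= in_itv /= => au; apply: aB.
  have [b [bT bu bx]] := fP u (covers_unit aT au) k.
  by rewrite (covers_inj aT bT au bu).
- move=> k a B aT mB SB; have [h1 h2] := T_unit aT.
  apply: (uniform_prob_le_itv (mfB _ mB) h1 (T_mass aT) h2).
  move=> u [/= Bu]; rewrite in_itv /= => h; rewrite in_itv /=.
  have [b [bT bu bx]] := fP u h k.
  by rewrite (piece_inj aT bT (SB _ (conj (rangeS u) Bu)) bx).
Qed.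

End Limit.

(** * The theorem *)

Lemma exists_scale (R : realType) (s r : R) :
  0 < r < s -> exists k, s / 2 ^+ k.+1 <= r < s / 2 ^+ k.
Proof.
move=> /andP[r0 rs]; have s0 := lt_trans r0 rs.
have small : exists k, s / 2 ^+ k <= r.
  have q1 : `|2^-1 : R| < 1 by rewrite ger0_norm; lra.
  have := cvg_expr q1 => /cvgrPdist_lt /(_ (r / s)); rewrite divr_gt0// => /(_ isT).
  move=> [k _ /(_ k (leqnn k))] /=; rewrite sub0r normrN.
  rewrite ger0_norm ?exprn_ge0// exprVn ltr_pdivlMr// mulrC => h.
  by exists k; exact: ltW.
case: (ex_minnP small) => -[|k] kr kmin.
  by move: kr; rewrite expr0 divr1 leNgt rs.
exists k; rewrite kr ltNge; apply/negP => h.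
by have := kmin k h; rewrite ltnn.
Qed.

Lemma scale_small (R : realType) (s d : R) :
  0 < s -> 0 < d -> exists k, s / 2 ^+ k < d.
Proof.
move=> s0 d0; have [ds|sd] := ltP d s; last first.
  exists 1%N; rewrite expr1; lra.
have [|k /andP[h _]] := @exists_scale R s (d / 2).
  by apply/andP; split; lra.
by exists k.+1; lra.
Qed.

Lemma scale_anti (R : realType) (s : R) (k j : nat) :
  0 <= s -> (k <= j)%N -> s / 2 ^+ j <= s / 2 ^+ k.
Proof.
move=> s0 kj; rewrite ler_wpM2l// lef_pV2 ?posrE ?exprn_gt0//.
by rewrite ler_eXn2l// ltr1n.
Qed.

Lemma doubling_gt0 (R : realType) (X : pmetricType R) (lambda : nat) :
  doubling X lambda -> (0 < lambda)%N.
Proof.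
case: lambda => // dX; have [|C [sub _]] := dX [set point].
  by exists 0 => x y -> ->; rewrite mdistxx.
by have [[]] := sub point erefl.
Qed.

Section ProbabilityOfBalls.
Context (R : realType) (X : pmetricType R) (P : probability (borel X) R).

(** Transfers estimates to the radius [0]: that ball is the limit of a
    decreasing sequence of balls, and [P] is continuous from above. *)
Lemma probability_mcball0 (x : X) (s c : R) :
  0 < s -> (forall k, (c%:E <= P (mcball x (s / 2 ^+ k)))%E) ->
  (c%:E <= P (mcball x 0))%E.
Proof.
move=> s0 cP; have -> : mcball x 0 = \bigcap_k mcball x (s / 2 ^+ k).
  apply/seteqP; split => y; rewrite /mcball /=.
    by move=> xy k _ /=; apply: le_trans xy _; rewrite divr_ge0// ?exprn_ge0// ltW.
  move=> h; rewrite leNgt; apply/negP => /(scale_small s0)[k].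
  by rewrite ltNge => /negP; apply; exact: h.
have cvgP : P \o (fun k => mcball x (s / 2 ^+ k)) @ \oo -->
    P (\bigcap_k mcball x (s / 2 ^+ k)).
  apply: nonincreasing_cvg_mu.
  - by apply: le_lt_trans (probability_le1 _ _) (ltry 1); exact: measurable_mcball.
  - by move=> k; exact: measurable_mcball.
  - by apply: bigcapT_measurable => k; exact: measurable_mcball.
  - move=> k j kj; apply/subsetPset => y; rewrite /mcball /= => /le_trans; apply.
    by apply: scale_anti => //; exact: ltW.
rewrite -(cvg_lim _ cvgP)//; apply: lime_ge; first by apply/cvg_ex; eexists; exact: cvgP.
by apply: nearW => k; exact: cP.
Qed.

Let m (A : set X) : R := fine (P (A : set (borel X))).

Lemma probability_fineE (A : set (borel X)) : measurable A -> P A = (m A)%:E.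
Proof. by move=> mA; rewrite fineK// fin_num_measure. Qed.

Lemma probability_closed_content :
  [/\ m set0 = 0,
    forall A B, closed A -> closed B -> A `<=` B -> m A <= m B,
    forall A B, closed A -> closed B -> m (A `|` B) <= m A + m B &
    m setT = 1].
Proof.
split.
- by rewrite /m measure0.
- move=> A B /measurable_closed_borel mA /measurable_closed_borel mB AB.
  by rewrite -lee_fin -!probability_fineE// le_measure ?inE.
- move=> A B /measurable_closed_borel mA /measurable_closed_borel mB.
  rewrite -lee_fin EFinD -!probability_fineE//; last exact: measurableU.
  exact: measureU2.
- by rewrite /m probability_setT.
Qed.

End ProbabilityOfBalls.

Section TreeBounds.
Context (R : realType) (X : pmetricType R) (mu nu : probability (borel X) R).
Variables (S : set X) (T : nat -> seq (node X R)) (lambda t : nat) (e0 : R).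
Let m (A : set X) : R := fine (mu (A : set (borel X))).
Let e k := e0 / 2 ^+ k.
Let p : R := 1 - t%:R^-1.
Let K : R := lambda%:R `^ (2 / t%:R).
Hypothesis t_gt0 : (0 < t)%N.
Hypothesis lambda_gt0 : (0 < lambda)%N.
Hypothesis e0_gt0 : 0 < e0.
Hypothesis X_diam : forall x y : X, mdist x y <= 64 * t%:R * e0.
Hypothesis T_root : T 0%N = [:: Node setT 0 1].
Hypothesis T_closed : forall k a, a \in T k -> closed (piece a).
Hypothesis T_diam : forall k a x y,
  a \in T k -> piece a x -> piece a y -> mdist x y <= 64 * t%:R * (e0 / 2 ^+ k).
Hypothesis T_ball : forall k a,
  a \in T k -> exists u, mcball u (e0 / 2 ^+ k / 80) `<=` piece a.
Hypothesis T_mass : forall k a, a \in T k ->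
  m (piece a) `^ p / 2 <= mass a <= K * m (piece a) `^ p.
Hypothesis T_gap : forall k a b x y, a \in T k -> b \in T k -> a != b ->
  piece a x -> piece b y -> 8 * (e0 / 2 ^+ k) <= mdist x y.
Hypothesis T_nested : forall k b, b \in T k.+1 ->
  exists2 a, a \in T k & piece b `<=` piece a.
Hypothesis S_compact : compact S.
Hypothesis nu_supported : supported_on nu S.
Hypothesis S_piece : forall k y, S y -> exists2 a, a \in T k & piece a y.
Hypothesis nu_ge : forall k a B, a \in T k -> measurable (B : set (borel X)) ->
  piece a `<=` B -> ((mass a)%:E <= nu B)%E.
Hypothesis nu_le : forall k a B, a \in T k -> measurable (B : set (borel X)) ->
  S `&` B `<=` piece a -> (nu B <= (mass a)%:E)%E.

Let t_ge1 : 1 <= t%:R :> R. Proof. by rewrite ler1n. Qed.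
Let tR_gt0 : 0 < t%:R :> R. Proof. by rewrite ltr0n. Qed.
Let e_gt0 k : 0 < e k. Proof. by rewrite divr_gt0// exprn_gt0. Qed.
Let eS k : e k = 2 * e k.+1.
Proof.
rewrite /e exprS; have : 0 < (2 : R) ^+ k by rewrite exprn_gt0.
by move=> h; field; rewrite gt_eqF.
Qed.
Let root_gt0 : 0 < 64 * t%:R * e0.
Proof. by rewrite !mulr_gt0. Qed.
Let p_ge0 : 0 <= p. Proof. by rewrite subr_ge0 invf_le1. Qed.
Let K_ge1 : 1 <= K.
Proof.
by rewrite -[leLHS](powRr0 lambda%:R) ler_powR ?ler1n// divr_ge0// ltW.
Qed.
Let K_gt0 : 0 < K. Proof. exact: lt_le_trans ltr01 K_ge1. Qed.
Let m_ge0 (A : set X) : 0 <= m A. Proof. by rewrite fine_ge0. Qed.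
Let m_setT : m setT = 1.
Proof. by have [] := probability_closed_content mu. Qed.
Let m_le (A B : set X) : closed A -> closed B -> A `<=` B -> m A <= m B.
Proof. by have [_ h _ _] := probability_closed_content mu; exact: h. Qed.
Let mp_le (A B : set X) :
  closed A -> closed B -> A `<=` B -> m A `^ p <= m B `^ p.
Proof.
by move=> cA cB AB; apply: ge0_ler_powR; rewrite ?nnegrE//; exact: m_le.
Qed.
Let mp_le1 (A : set X) : closed A -> m A `^ p <= 1.
Proof.
move=> cA; rewrite -[leRHS](_ : m setT `^ p = _); last by rewrite m_setT powR1.
by apply: mp_le => //; exact: closedT.
Qed.
Let mE (x : X) (r : R) : mu (mcball x r) = (m (mcball x r))%:E.
Proof. by rewrite (@probability_fineE _ _ mu)//; exact: measurable_mcball. Qed.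

Lemma tree_distortion : (ultrametric_distortion S <= (16 * t%:R)%:E)%E.
Proof.
apply: ultrametric_distortion_le; first by have := t_ge1; lra.
apply: (@embeds_of_levels R X S
  (fun k x y => exists a, [/\ a \in T k, piece a x & piece a y])
  (fun k => 64 * t%:R * e k)).
- by move=> k; rewrite !mulr_gt0.
- move=> k j kj; rewrite ler_pM2l ?mulr_gt0//.
  by apply: scale_anti => //; exact: ltW.
- move=> d d0; have [k kd] := scale_small root_gt0 d0.
  by exists k; rewrite /e mulrA.
- by move=> k x y [a [aT ax ay]]; exists a.
- move=> k x y z Sx Sy Sz [a [aT ax az]] [b [bT bz yb]]; exists a; split => //.
  have [->//|ab] := eqVneq a b.
  have := T_gap aT bT ab az bz; rewrite mdistxx -/(e k) leNgt => /negP[].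
  by rewrite mulr_gt0.
- move=> k j x y; elim: j => [|j IH]; first by rewrite leqn0 => /eqP ->.
  rewrite leq_eqVlt => /predU1P[->//|/IH h] [a [aT ax ay]]; apply: h.
  by have [b bT ab] := T_nested aT; exists b; split => //; exact: ab.
- move=> x y Sx Sy; exists (Node setT 0 1); split => //.
  by rewrite T_root mem_head.
- by move=> k x y [a [aT ax ay]]; exact: T_diam aT ax ay.
- move=> k x y Sx Sy nE; have [a aT ax] := S_piece k.+1 Sx.
  have [b bT yb] := S_piece k.+1 Sy.
  have [ab|ab] := eqVneq a b.
    by exfalso; apply: nE; exists a; split => //; rewrite ab.
  have := T_gap aT bT ab ax yb; rewrite -/(e k.+1) /= (eS k) => gap.
  have -> : 64 * t%:R * (2 * e k.+1) = 16 * t%:R * (8 * e k.+1) by ring.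
  by rewrite ler_pM2l ?mulr_gt0.
Qed.

(** The points of [S] in a ball smaller than half the gap of level [k] all lie
    in one piece of that level, which is not much larger than the ball. *)
Let upper_pos (x : X) (r : R) : 0 < r ->
  (nu (mcball x r) <= (K * m (mcball x (33 * t%:R * r)) `^ p)%:E)%E.
Proof.
move=> r0; have tr : r <= t%:R * r by rewrite ler_peMl// ltW.
have [big|small] := leP (4 * e0) r.
  have -> : mcball x (33 * t%:R * r) = setT.
    apply/seteqP; split => // y _; rewrite /mcball /=.
    apply: le_trans (X_diam x y) _; rewrite -!mulrA.
    have : t%:R * (4 * e0) <= t%:R * r by rewrite ler_pM2l.
    have : 0 < t%:R * e0 by rewrite mulr_gt0.
    by lra.
  rewrite m_setT powR1 mulr1; apply: le_trans (probability_le1 _ _) _.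
    exact: measurable_mcball.
  by rewrite lee_fin.
have [|k /andP[kr rk]] := @exists_scale R (4 * e0) r; first by rewrite r0.
rewrite -mulrA -/(e k.+1) in kr; rewrite -mulrA -/(e k) in rk.
have [[y [Sy xy]]|h] := pselect (S `&` mcball x r !=set0); last first.
  rewrite (_ : nu (mcball x r) = 0%E).
    by rewrite lee_fin mulr_ge0 ?powR_ge0.
  apply/eqP; rewrite eq_le measure_ge0 andbT -nu_supported; apply: le_measure.
  - by rewrite inE; exact: measurable_mcball.
  - rewrite inE; apply: measurableC; apply: measurable_closed_borel.
    exact: compact_closed (@metric_hausdorff _ _) S_compact.
  - by move=> y xy Sy; apply: h; exists y.
have [a aT ay] := S_piece k Sy; have /andP[_ aup] := T_mass aT.
move: xy; rewrite /mcball /= => xy.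
apply: (@le_trans _ _ (mass a)%:E).
  apply: (nu_le aT); first exact: measurable_mcball.
  move=> z [Sz]; rewrite /mcball /= => xz; have [b bT bz] := S_piece k Sz.
  have [->//|ab] := eqVneq a b; exfalso.
  have := T_gap aT bT ab ay bz; have := metric_triangle y x z.
  rewrite -/(e k) (metric_sym y x) => h1 h2.
  by lra.
rewrite lee_fin; apply: le_trans aup _.
rewrite ler_pM2l//; apply: mp_le; [exact: T_closed aT|exact: closed_mcball|].
move=> z az; rewrite /mcball /=; have := T_diam aT ay az.
have : t%:R * (4 * e k.+1) <= t%:R * r by rewrite ler_pM2l.
rewrite -/(e k) (eS k) -!mulrA; have := metric_triangle x y z.
by lra.
Qed.

Lemma tree_upper (x : X) (r : R) : 0 <= r ->
  (nu (mcball x r) <= K%:E * mu (mcball x (33 * t%:R * r)) `^ p)%E.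
Proof.
rewrite le_eqVlt mE poweR_EFin -EFinM => /predU1P[<-|]; last exact: upper_pos.
(* for radius 0 the bound is inverted, to be a lower bound on [mu] of a ball *)
rewrite mulr0; set c := nu (mcball x 0).
have cfin : c = (fine c)%:E.
  by rewrite fineK// fin_num_measure//; exact: measurable_mcball.
have ck k : fine c <= K * m (mcball x (33 * t%:R * e k)) `^ p.
  rewrite -lee_fin -cfin; apply: le_trans (upper_pos x (e_gt0 k)).
  apply: le_measure; rewrite ?inE//; try exact: measurable_mcball.
  by move=> z; rewrite /mcball /= => /le_trans; apply; exact: ltW.
rewrite cfin lee_fin; have [p0|pn0] := eqVneq p 0.
  by have := ck 0%N; rewrite p0 !powRr0.
have pV0 : 0 <= p^-1 by rewrite invr_ge0.
have c0 : 0 <= fine c / K by rewrite divr_ge0 ?(ltW K_gt0)//; exact/fine_ge0/measure_ge0.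
pose b := (fine c / K) `^ p^-1.
have bp : b `^ p = fine c / K by rewrite /b -powRrM mulVf// powRr1.
have b0 : 0 <= b by rewrite powR_ge0.
have : (b%:E <= mu (mcball x 0))%E.
  apply: (@probability_mcball0 _ _ _ _ (33 * t%:R * e0)); first by rewrite !mulr_gt0.
  move=> k; rewrite -mulrA -/(e k) mE lee_fin.
  rewrite -[leRHS](@powRr1 _ (m _)) -?[X in _ `^ X](mulfV pn0)//.
  rewrite powRrM; apply: ge0_ler_powR; rewrite ?nnegrE// ?powR_ge0//.
  by rewrite ler_pdivrMr// mulrC.
rewrite mE lee_fin => bm; rewrite -ler_pdivrMl// mulrC -bp.
by apply: ge0_ler_powR; rewrite ?nnegrE.
Qed.

(** The piece of level [k] at [y] contains a ball and lies in the ball around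
    [y] whose radius is the bound on its diameter. *)
Let lower_piece k (y : X) : S y -> exists u, [/\
  mcball u (e k / 80) `<=` mcball y (64 * t%:R * e k),
  ((m (mcball y 0) `^ p / 2)%:E <= nu (mcball y (64 * t%:R * e k)))%E &
  ((m (mcball u (e k / 80)) `^ p / 2)%:E <=
    nu (mcball y (64 * t%:R * e k)))%E].
Proof.
move=> Sy; have [a aT ay] := S_piece k Sy.
have [u ua] := T_ball aT; have /andP[alow _] := T_mass aT.
have acl := T_closed aT.
have sub : piece a `<=` mcball y (64 * t%:R * e k).
  by move=> z; exact: T_diam aT ay.
have nua : ((mass a)%:E <= nu (mcball y (64 * t%:R * e k)))%E.
  by apply: (nu_ge aT) => //; exact: measurable_mcball.
exists u; split; first exact: subset_trans sub.
  apply: le_trans nua; rewrite lee_fin; apply: le_trans alow.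
  rewrite ler_pM2r ?invr_gt0//; apply: mp_le => //; first exact: closed_mcball.
  move=> z; rewrite /mcball /= => yz.
  suff <- : y = z by [].
  by apply: mdist_positivity; apply/le_anti; rewrite yz mdist_ge0.
apply: le_trans nua; rewrite lee_fin; apply: le_trans alow.
rewrite ler_pM2r ?invr_gt0//; apply: mp_le => //; exact: closed_mcball.
Qed.

Lemma tree_lower (c : R) (y : X) (r : R) :
  0 < c -> c * 128 = 80^-1 -> S y -> 0 <= r ->
  exists x : X, mcball x (c * r / t%:R) `<=` mcball y r /\
    ((lambda%:R `^ (- (2 / t%:R)) / 2)%:E * mu (mcball x (c * r / t%:R)) `^ p
      <= nu (mcball y r))%E.
Proof.
move=> c0 cE Sy r_ge0.
have KV1 : K^-1 <= 1 by rewrite invf_le1.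
have KV0 : 0 <= K^-1 by rewrite invr_ge0 ltW.
have -> : lambda%:R `^ (- (2 / t%:R)) = K^-1 by rewrite powRN.
have shrink (A : set X) : K^-1 / 2 * m A `^ p <= m A `^ p / 2.
  by rewrite mulrAC ler_pM2r ?invr_gt0// ler_piMl ?powR_ge0.
move: r_ge0; rewrite le_eqVlt => /predU1P[<-|r0].
  exists y; rewrite mulr0 mul0r; split => //; rewrite mE poweR_EFin -EFinM.
  apply: (@probability_mcball0 _ _ _ _ (64 * t%:R * e0)) => // k.
  have [u [_ h _]] := lower_piece k Sy; rewrite -mulrA -/(e k).
  by apply: le_trans h; rewrite lee_fin.
have [big|small] := leP (64 * t%:R * e0) r.
  have yT : mcball y r = setT.
    by apply/seteqP; split => // z _; exact: le_trans (X_diam y z) big.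
  exists y; split; first by rewrite yT.
  rewrite yT probability_setT mE poweR_EFin -EFinM lee_fin.
  apply: le_trans (shrink _) _; rewrite ler_pdivrMr// mul1r.
  by apply: le_trans (mp_le1 (@closed_mcball _ _ _ _)) _; rewrite ler1n.
have [|k /andP[kr rk]] := @exists_scale R (64 * t%:R * e0) r; first by rewrite r0.
rewrite -mulrA -/(e k.+1) in kr; rewrite -mulrA -/(e k) in rk.
have [u [usub _ hu]] := lower_piece k.+1 Sy.
have ball_le : mcball y (64 * t%:R * e k.+1) `<=` mcball y r.
  by move=> z; rewrite /mcball /= => /le_trans; apply.
have rad_le : c * r / t%:R <= e k.+1 / 80.
  rewrite ler_pdivrMr//; apply: (@le_trans _ _ (c * (64 * t%:R * e k))).
    by rewrite ler_pM2l// ltW.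
  rewrite (eS k); have -> : c * (64 * t%:R * (2 * e k.+1)) =
    c * 128 * e k.+1 * t%:R by ring.
  by rewrite cE (mulrC 80^-1).
have u_le : mcball u (c * r / t%:R) `<=` mcball u (e k.+1 / 80).
  by move=> z; rewrite /mcball /= => /le_trans; apply.
exists u; split; first exact: subset_trans (subset_trans u_le usub) ball_le.
apply: (@le_trans _ _ (nu (mcball y (64 * t%:R * e k.+1)))); last first.
  by apply: le_measure; rewrite ?inE//; exact: measurable_mcball.
apply: le_trans hu; rewrite mE poweR_EFin -EFinM lee_fin.
apply: le_trans (shrink _) _; rewrite ler_pM2r ?invr_gt0//.
apply: mp_le => //; exact: closed_mcball.
Qed.

End TreeBounds.

Theorem theorem1p2 (R : realType) :
  exists C1 c1 : R, [/\ 0 < C1, 0 < c1 &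
    forall (X : pmetricType R) (lambda : nat) (mu : probability (borel X) R),
      compact [set: X] -> doubling X lambda ->
      forall t : nat, (1 <= t)%N ->
      exists (S : set X) (nu : probability (borel X) R),
        [/\ compact S, supported_on nu S,
            (ultrametric_distortion S <= (16 * t%:R)%:E)%E,
            (forall (x : X) (r : R), 0 <= r ->
              (nu (mcball x r) <=
                (lambda%:R `^ (2 / t%:R))%:E *
                mu (mcball x (C1 * t%:R * r)) `^ (1 - t%:R^-1))%E)
          & forall (y : X) (r : R), S y -> 0 <= r ->
              exists x : X,
                mcball x (c1 * r / t%:R) `<=` mcball y r /\
                ((lambda%:R `^ (- (2 / t%:R)) / 2)%:E *
                 mu (mcball x (c1 * r / t%:R)) `^ (1 - t%:R^-1)
                 <= nu (mcball y r))%E]].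
Proof.
have [c1 c10 c1E] : exists2 c1 : R, 0 < c1 & c1 * 128 = 80^-1.
  by exists (80^-1 / 128); [rewrite divr_gt0 ?invr_gt0|rewrite divfK].
(* 33: a piece of diameter 64 * t * e k that meets a ball of radius r, with
   4 * e k.+1 <= r, lies in the concentric ball of radius 32 * t * r + r;
   c1: a piece of level k.+1 contains a ball of radius e k.+1 / 80, where
   r < 64 * t * e k = 128 * t * e k.+1 *)
exists 33, c1; split => // X lambda mu cX dX t t0.
have [M M0 MX] := compact_bounded cX.
have T0 : 0 < t%:R :> R by rewrite ltr0n.
have [e0 e00 e0M] : exists2 e0 : R, 0 < e0 & 64 * t%:R * e0 = M.
  exists (M / (64 * t%:R)); first by rewrite divr_gt0 ?mulr_gt0.
  by rewrite mulrC divfK// gt_eqF// mulr_gt0.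
have X_diam (x y : X) : mdist x y <= 64 * t%:R * e0 by rewrite e0M.
have e_gt0 k : 0 < e0 / 2 ^+ k by rewrite divr_gt0// exprn_gt0.
have [N [C [Ccl Ccov Crad Cball Cspl]]] := exists_nested_cubes cX e00.
have [m0 mle mU mT] := probability_closed_content mu.
have l0 := doubling_gt0 dX.
have [|T [Tprop Troot Tcov Tapart Tnest]] := exists_node_tree m0 mle mU mT t0
  e00 dX l0 Ccl Ccov Crad Cball Cspl X_diam; first by exists point.
have Tcl k a : a \in T k -> closed (piece a) by move=> /Tprop[].
have Tdiam k a x y : a \in T k -> piece a x -> piece a y ->
    mdist x y <= 64 * t%:R * (e0 / 2 ^+ k).
  by move=> /Tprop[_ + _ _ _]; exact.
have Tball k a : a \in T k -> exists u, mcball u (e0 / 2 ^+ k / 80) `<=` piece a.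
  by move=> /Tprop[].
have [||||S [nu [cS nuS Spiece nu_ge nu_le]]] := exists_tree_measure
    (D := fun k => 64 * t%:R * (e0 / 2 ^+ k)) (g := fun k => 8 * (e0 / 2 ^+ k))
    cX _ _ Tcl _ Tdiam _ Troot Tcov Tapart Tnest.
- by move=> k; rewrite mulr_gt0.
- move=> d d0; have [|k kd] := @scale_small R (64 * t%:R * e0) d _ d0.
    by rewrite e0M.
  by exists k; rewrite mulrA.
- move=> k a /Tball[u ua]; exists u; apply: ua; apply: mcball_center.
  by rewrite divr_ge0// ltW.
- by move=> k a /Tprop[_ _ _ /ltW].
have Tgap k a b x y : a \in T k -> b \in T k -> a != b ->
    piece a x -> piece b y -> 8 * (e0 / 2 ^+ k) <= mdist x y.
  by move=> aT bT ab; exact: (Tapart k a b aT bT ab).2.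
have Tmass k a (aT : a \in T k) := let: And5 _ _ _ _ h := Tprop k a aT in h.
have Tsub k b : b \in T k.+1 -> exists2 a, a \in T k & piece b `<=` piece a.
  by move=> /Tnest[a [aT ba _ _]]; exists a.
exists S, nu; split => //.
- exact: (tree_distortion t0 e00 Troot Tdiam Tgap Tsub Spiece).
- by move=> x r; apply: tree_upper; eassumption.
- by move=> y r; apply: tree_lower; eassumption.
Qed.
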